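(* There is a tiling $T$ of the plane that satisfies the Arrow rule everywhere except in a bounded region (i.e. there is a bounded set $D\subset\mathbb R^2$ such that any two tiles of $T$ that violate the Arrow rule with respect to each other are both contained in $D$) and that has the following property: for every A2 tiling $T'$ of the plane the set difference $T\setminus T'$ is infinite.
   Context: **Tiles.** Let $\psi=\sqrt{(\sqrt5-1)/2}$, so $\psi^4+\psi^2=1$. Let $B$ be the closed hexagonal region with consecutive vertices $(0,0),(\psi,0),(\psi,\psi^2),(\psi^3,\psi^2),(\psi^3,1),(0,1)$. A tile (Golden Bee) of size $d>0$ is any set $f(B)$, where $f$ is a similarity of the plane (orientation-reversing ones allowed) with ratio $d$; its longest side has length $d$. Since $B$ has no nontrivial symmetry, $f$ is determined by the tile. **Tilings.** Large $d$-tiles are tiles of size $d$, small $d$-tiles are tiles of size $\psi d$; a $d$-tile is a large or small $d$-tile. A $d$-tiling is a non-empty set of $d$-tiles with pairwise disjoint interiors; a tiling is a $d$-tiling for some $d$. It is a tiling of the union of its tiles. **Arrow rule.** Boundaries of $d$-tiles are divided into directed segments with colors in $\{3,4,5,6\}$ (color $i$ has length $d\psi^i$). Below, $P\to Q: i$ means the segment directed from $P$ to $Q$ with color $i$, given for $B$ and carried to the tile $f(B)$ by $f$. Large $d$-tile ($f$ of ratio $d$): $(0,0)\to(0,\psi^4):4$; $(0,2\psi^4)\to(0,\psi^4):4$; $(0,1)\to(0,2\psi^4):6$; $(\psi,0)\to(\psi^3,0):5$; $(\psi^3,0)\to(0,0):3$; $(\psi,\psi^2)\to(\psi,\psi^4):6$;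 $(\psi,\psi^4)\to(\psi,0):4$; $(\psi^3,\psi^2)\to(\psi,\psi^2):5$; $(\psi^3,1)\to(\psi^3,\psi^2):4$; $(0,1)\to(\psi^3,1):3$. Small $d$-tile ($f$ of ratio $d\psi$): $(0,0)\to(0,\psi^4):5$; $(0,\psi^4)\to(0,1):3$; $(\psi,0)\to(\psi^3,0):6$; $(\psi^3,0)\to(0,0):4$; $(\psi,0)\to(\psi,\psi^2):3$; $(\psi^3,\psi^2)\to(\psi,\psi^2):6$; $(\psi^3,1)\to(\psi^3,\psi^2):5$; $(0,1)\to(\psi^3,1):4$. Two distinct tiles of a $d$-tiling satisfy the Arrow rule with respect to each other if, whenever a segment $e$ of the one and a segment $e'$ of the other have more than one common point, $e$ and $e'$ coincide as segments and have the same color and the same direction; otherwise they violate it. A $d$-tiling satisfies the Arrow rule if all pairs of its distinct tiles do. An A2 tiling is a tiling that satisfies the Arrow rule. *)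

(* Defs.v *)
(* MathComp-Analysis; the real numbers are an arbitrary R : realType. *)
From HB Require Import structures.
From mathcomp Require Import all_boot all_order all_algebra.
From mathcomp Require Import all_classical all_reals all_analysis.
Set Implicit Arguments.
Unset Strict Implicit.
Unset Printing Implicit Defensive.
Import Order.TTheory GRing.Theory Num.Theory.
Import numFieldNormedType.Exports.
Local Open Scope classical_set_scope.
Local Open Scope ring_scope.

(* The library's norm on R * R is the maximum norm, which induces the usual
   topology and bounded sets; similarities need the Euclidean distance. *)
Definition eucl_dist (R : realType) (p q : R * R) : R :=
  Num.sqrt ((p.1 - q.1) ^+ 2 + (p.2 - q.2) ^+ 2).

Definition similarity (R : realType) (r : R) (f : R * R -> R * R) : Prop :=
  0 < r /\ forall p q, eucl_dist (f p) (f q) = r * eucl_dist p q.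

Definition psi (R : realType) : R := Num.sqrt ((Num.sqrt 5 - 1) / 2).

(* The closed L-shaped hexagon with consecutive vertices
   (0,0), (psi,0), (psi,psi^2), (psi^3,psi^2), (psi^3,1), (0,1),
   as the union of a horizontal and a vertical rectangle. *)
Definition bee (R : realType) : set (R * R) :=
  (`[0, psi R] `*` `[0, psi R ^+ 2]) `|` (`[0, psi R ^+ 3] `*` `[0, 1]).
Arguments bee R : clear implicits.

Definition tile (R : realType) (d : R) (X : set (R * R)) : Prop :=
  exists2 f, similarity d f & X = f @` bee R.

Definition d_tile (R : realType) (d : R) (X : set (R * R)) : Prop :=
  tile d X \/ tile (psi R * d) X.

Definition d_tiling (R : realType) (d : R) (T : set (set (R * R))) : Prop :=
  [/\ 0 < d, T !=set0, (forall X, T X -> d_tile d X)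
    & trivIset T (fun X => interior X)].

Definition of_plane (R : realType) (T : set (set (R * R))) : Prop :=
  \bigcup_(X in T) X = setT.

(* (P, Q, i) is the segment directed from P to Q with color i. *)
Definition arrow (R : realType) : Type := ((R * R) * (R * R) * nat)%type.

Definition source (R : realType) (e : arrow R) : R * R := e.1.1.
Definition target (R : realType) (e : arrow R) : R * R := e.1.2.
Definition color (R : realType) (e : arrow R) : nat := e.2.
Definition direction (R : realType) (e : arrow R) : R * R :=
  target e - source e.

Definition segment (R : realType) (e : arrow R) : set (R * R) :=
  [set source e + t *: direction e | t in `[0, 1]].

Definition map_arrow (R : realType) (f : R * R -> R * R) (e : arrow R) :
  arrow R := (f (source e), f (target e), color e).

Definition large_arrows (R : realType) : seq ((R * R) * (R * R) * nat) :=
  let s := psi R in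
  [:: ((0, 0), (0, s ^+ 4), 4%N);
      ((0, 2 * s ^+ 4), (0, s ^+ 4), 4%N);
      ((0, 1), (0, 2 * s ^+ 4), 6%N);
      ((s, 0), (s ^+ 3, 0), 5%N);
      ((s ^+ 3, 0), (0, 0), 3%N);
      ((s, s ^+ 2), (s, s ^+ 4), 6%N);
      ((s, s ^+ 4), (s, 0), 4%N);
      ((s ^+ 3, s ^+ 2), (s, s ^+ 2), 5%N);
      ((s ^+ 3, 1), (s ^+ 3, s ^+ 2), 4%N);
      ((0, 1), (s ^+ 3, 1), 3%N)].

Definition small_arrows (R : realType) : seq ((R * R) * (R * R) * nat) :=
  let s := psi R in
  [:: ((0, 0), (0, s ^+ 4), 5%N);
      ((0, s ^+ 4), (0, 1), 3%N);
      ((s, 0), (s ^+ 3, 0), 6%N);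
      ((s ^+ 3, 0), (0, 0), 4%N);
      ((s, 0), (s, s ^+ 2), 3%N);
      ((s ^+ 3, s ^+ 2), (s, s ^+ 2), 6%N);
      ((s ^+ 3, 1), (s ^+ 3, s ^+ 2), 5%N);
      ((0, 1), (s ^+ 3, 1), 4%N)].

(* The arrows of X regarded as a d-tile. The hexagon has no nontrivial
   symmetry, so X determines the ratio of f and f itself on the whole plane:
   at most one of the two cases applies, with a unique f. *)
Definition tile_arrows (R : realType) (d : R) (X : set (R * R)) :
  set (arrow R) :=
  [set e | exists f,
    [/\ similarity d f, X = f @` bee R
      & exists2 e0, e0 \in large_arrows R & e = map_arrow f e0]
    \/ [/\ similarity (psi R * d) f, X = f @` bee R
      & exists2 e0, e0 \in small_arrows R & e = map_arrow f e0]].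

(* For arrows with the same underlying segment, having the same direction
   amounts to having equal displacement vectors. *)
Definition arrow_compatible (R : realType) (d : R) (X Y : set (R * R)) : Prop :=
  forall e e', tile_arrows d X e -> tile_arrows d Y e' ->
  (exists p q, [/\ p <> q, (segment e `&` segment e') p
                 & (segment e `&` segment e') q]) ->
  [/\ segment e = segment e', color e = color e'
    & direction e = direction e'].

Definition arrow_violation (R : realType) (d : R) (X Y : set (R * R)) : Prop :=
  X <> Y /\ ~ arrow_compatible d X Y.

Definition arrow_rule (R : realType) (d : R) (T : set (set (R * R))) : Prop :=
  forall X Y, T X -> T Y -> X <> Y -> arrow_compatible d X Y.

(* A tiling all of whose tiles have the same size is a d-tiling for two values
   of d, hence the existential scope of d over both conditions. *)
Definition A2_tiling (R : realType) (T : set (set (R * R))) : Prop :=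
  exists2 d : R, d_tiling d T & arrow_rule d T.

(* Main.v *)
(* Subdividing a small tile twice and enlarging the result by psi^-2 gives a
   patch containing the tile again; iterating, the patches exhaust the upper
   half plane by tiles matching each other.  The tiling T consists of this half
   plane and its half turn.  Along the axis the two halves match outside
   [-1, 1], but the arrows in [-1, 1] do not match.

   That this cannot be repaired by changing finitely many tiles follows from a
   conserved quantity.  Count an arrow of color 3 from P to Q with weight
   |Q|^2 - |P|^2, an arrow of color 6 with weight (3 psi^2 - 2) d^2, and all
   others with 0, with opposite signs for tiles on the left and on the right of
   the arrow.  The weights around any d-tile sum to 0.  If T' is an A2 tiling
   and T \ T' is finite, then so is T' \ T, and summing over the tiles of T \ T'
   and of T' \ T shows that the weights of the unmatched arrows of T sum to 0,
   since matched arrows cancel.  But the weights on [-1, 1] have a nonzero sum.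
   If T' uses another d, it shares with T only tiles of one kind, while T has
   infinitely many tiles of each kind. *)
Require Import Defs.
From HB Require Import structures.
From mathcomp Require Import all_boot all_order all_algebra.
From mathcomp Require Import all_classical all_reals all_analysis.
From mathcomp Require Import ring lra zify.
Set Implicit Arguments.
Unset Strict Implicit.
Unset Printing Implicit Defensive.
Import Order.TTheory GRing.Theory Num.Theory.
Import numFieldNormedType.Exports.
Local Open Scope classical_set_scope.
Local Open Scope ring_scope.

(** The Arrow rule only constrains arrows that overlap. The cancellation needs more: every arrow of
    an A2 tiling of the plane must also be an arrow of a tile on its other side. This follows from
    covering: only finitely many tiles come near an arrow, and if none of them shared it, their
    boundaries would meet it in finitely many points only.

    The two halves match outside [-1, 1] because of how subdivision acts on the axis. Two
    subdivisions followed by the growth turn the four arrows of [core] into these four again and two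
    new ones, [outward] and its half turn. So the halves agree on the new arrows. They keep agreeing
    on all that descends from these, since the growth commutes with the half turn and the parts of
    an arrow depend on that arrow alone.

    All constructions are done with placements, which are data. Only near the end are they
    identified with tiles as sets of points, and this is where the hexagon must be shown to have no
    symmetry. *)

Section PsiFacts.
Variable R : realType.
Local Notation s := (psi R).

Lemma psi_gt0 : 0 < s.
Proof.
rewrite /psi sqrtr_gt0 divr_gt0 // subr_gt0 -[ltLHS]sqrtr1 ltr_sqrt; lra.
Qed.

Lemma psi4 : s ^+ 4 = 1 - s ^+ 2.
Proof.
have h5 : Num.sqrt 5 ^+ 2 = 5 :> R by rewrite sqr_sqrtr; lra.
have h1 : 1 <= Num.sqrt 5 :> R by rewrite -[leLHS]sqrtr1 ler_sqrt; lra.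
have -> : s ^+ 4 = (s ^+ 2) ^+ 2 by rewrite -exprM.
rewrite /psi sqr_sqrtr; last by rewrite divr_ge0 // subr_ge0.
by field: h5.
Qed.

(** Rational bounds sharp enough to leave the later inequalities between powers of psi to linear
    arithmetic. The value of [s ^+ 2] is about 0.618. *)
Lemma psi_bounds : [/\ 3 / 4 < s, s < 4 / 5,
  3 / 5 < s ^+ 2 < 5 / 8 & 9 / 20 < s ^+ 3 < 1 / 2].
Proof.
have s0 := psi_gt0; have s4 := psi4.
have s2 : 3 / 5 < s ^+ 2 < 5 / 8.
  have p2 : 0 < s ^+ 2 by rewrite exprn_gt0.
  (* Completing the square in psi^4 + psi^2 = 1. *)
  have e : (s ^+ 2 + 1 / 2) ^+ 2 = 5 / 4 by field: s4.
  have [h1 h2] : 11 / 10 < s ^+ 2 + 1 / 2 /\ s ^+ 2 + 1 / 2 < 9 / 8.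
    by split; rewrite -ltr_sqr ?nnegrE ?e; lra.
  lra.
have [s1 s1'] : 3 / 4 < s /\ s < 4 / 5.
  move: s2; rewrite expr2 => /andP[? ?].
  by split; rewrite -ltr_sqr ?nnegrE ?expr2; lra.
have h : s ^+ 3 = s * s ^+ 2 by ring.
split; [lra|lra|exact: s2|].
have : 3 / 4 * (3 / 5) < s ^+ 3 by rewrite h; apply: ltr_pM; lra.
have : s ^+ 3 < 4 / 5 * (5 / 8) by rewrite h; apply: ltr_pM; lra.
lra.
Qed.

Lemma psi_powers : [/\ s ^+ 5 = s - s ^+ 3, s ^+ 6 = 2 * s ^+ 2 - 1,
  s ^+ 7 = 2 * s ^+ 3 - s & s ^+ 8 = 2 - 3 * s ^+ 2].
Proof. have h := psi4; split; ring: h. Qed.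

Lemma psi_order : [/\ 0 < s ^+ 3, s ^+ 3 < s ^+ 2, s ^+ 2 < s, s < 1 &
  1 / 2 < s ^+ 2 < 2 / 3 /\ s ^+ 4 = 1 - s ^+ 2].
Proof. by have [? ? ? ?] := psi_bounds; split; rewrite ?psi4; lra. Qed.

End PsiFacts.

(** * Similarities of the plane in coordinates *)

Section Placements.
Variable R : realType.
Local Notation s := (psi R).
Implicit Types (p q v : R * R) (e : arrow R).

(* A placement encodes the similarity sending (x, y) to the point with complex
   coordinate o + x u + y (+/- i u), together with the kind of the tile. *)
Record placement := Placement {
  origin : R * R; axis : R * R; flipped : bool; is_large : bool }.
Implicit Types t h : placement.

Definition flip_sign t : R := (-1) ^+ flipped t.

Definition lin t p : R * R :=
  ((axis t).1 * p.1 - flip_sign t * (axis t).2 * p.2,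
   (axis t).2 * p.1 + flip_sign t * (axis t).1 * p.2).

Definition app t p : R * R := origin t + lin t p.

Definition ratio2 t : R := (axis t).1 ^+ 2 + (axis t).2 ^+ 2.

Definition unapp t q : R * R :=
  let w := q - origin t in
  (((axis t).1 * w.1 + (axis t).2 * w.2) / ratio2 t,
   flip_sign t * ((axis t).1 * w.2 - (axis t).2 * w.1) / ratio2 t).

(** The kind is that of [h], since [t] acts here as a mere similarity. *)
Definition cmp t h : placement :=
  Placement (app t (origin h)) (lin t (axis h))
    (flipped t (+) flipped h) (is_large h).

Lemma flip_sign_sqr t : flip_sign t ^+ 2 = 1.
Proof. exact: sqrr_sign. Qed.

Lemma flip_sign_cmp t h : flip_sign (cmp t h) = flip_sign t * flip_sign h.
Proof. exact: signr_addb. Qed.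

Lemma lin_cmp t h p : lin (cmp t h) p = lin t (lin h p).
Proof.
have ht := flip_sign_sqr t.
by rewrite /lin flip_sign_cmp /=; congr pair; ring: ht.
Qed.

Lemma linD t p q : lin t (p + q) = lin t p + lin t q.
Proof. by rewrite /lin /=; congr pair; rewrite /=; ring. Qed.

Lemma linZ t (a : R) p : lin t (a *: p) = a *: lin t p.
Proof. by rewrite /lin /=; congr pair; rewrite /= /GRing.scale /=; ring. Qed.

Lemma linB t p q : lin t (p - q) = lin t p - lin t q.
Proof. by rewrite -scaleN1r linD linZ scaleN1r. Qed.

Lemma app_cmp t h p : app (cmp t h) p = app t (app h p).
Proof. by rewrite /app lin_cmp linD addrA. Qed.

Lemma app_sub t p q : app t p - app t q = lin t (p - q).
Proof. by rewrite linB /app opprD addrACA subrr add0r. Qed.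

Lemma app_conv t p v (a : R) : app t (p + a *: v) = app t p + a *: lin t v.
Proof. by rewrite /app linD linZ addrA. Qed.

Lemma ratio2_cmp t h : ratio2 (cmp t h) = ratio2 t * ratio2 h.
Proof. by rewrite /ratio2 /=; have ht := flip_sign_sqr t; ring: ht. Qed.

Lemma appK t : 0 < ratio2 t -> cancel (app t) (unapp t).
Proof.
move=> h0 [x y]; have ht := flip_sign_sqr t.
have h1 : ratio2 t != 0 by rewrite gt_eqF.
rewrite /unapp /app /lin /=; congr pair; apply: (mulIf h1); rewrite divfK //;
  rewrite /ratio2; ring: ht.
Qed.

Lemma unappK t : 0 < ratio2 t -> cancel (unapp t) (app t).
Proof.
move=> h0 [x y]; have ht := flip_sign_sqr t.
have h1 : ratio2 t != 0 by rewrite gt_eqF.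
have hi : (ratio2 t)^-1 * (axis t).1 ^+ 2 = 1 - (ratio2 t)^-1 * (axis t).2 ^+ 2.
  by rewrite -{1}(mulVf h1) /ratio2; ring.
rewrite /unapp /app /lin /=; move: (_^-1) hi => i hi.
by rewrite [LHS]surjective_pairing /=; congr pair; ring: ht hi.
Qed.

Lemma lin_norm t p :
  (lin t p).1 ^+ 2 + (lin t p).2 ^+ 2 = ratio2 t * (p.1 ^+ 2 + p.2 ^+ 2).
Proof. by rewrite /ratio2 /=; have ht := flip_sign_sqr t; ring: ht. Qed.

Lemma app_inj t : 0 < ratio2 t -> injective (app t).
Proof. by move=> /appK /can_inj. Qed.

Lemma app_image t (A : set (R * R)) q : 0 < ratio2 t ->
  (app t @` A) q <-> A (unapp t q).
Proof.
move=> h; split=> [[p Ap <-]|]; first by rewrite appK.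
by move=> Aq; exists (unapp t q); rewrite ?unappK.
Qed.

End Placements.

(** Classical equality and choice allow finite sets of placements to be listed by sequences. *)
HB.instance Definition _ (R : realType) := gen_eqMixin (placement R).
HB.instance Definition _ (R : realType) := gen_choiceMixin (placement R).

(** * Segments and overlapping arrows *)

Section Segments.
Variable R : realType.
Implicit Types (p q v : R * R) (e : arrow R) (t : placement R).

Lemma segmentP e p :
  segment e p <-> exists2 a : R, 0 <= a <= 1 & p = source e + a *: direction e.
Proof.
split=> [[a /=]|[a ha ->]]; first by rewrite in_itv /= => ha <-; exists a.
by exists a; rewrite /= ?in_itv.
Qed.

Lemma segment_source e : segment e (source e).
Proof. by apply/segmentP; exists 0; rewrite ?scale0r ?addr0 // lexx ler01. Qed.

Lemma segment_target e : segment e (target e).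
Proof.
apply/segmentP; exists 1; first by rewrite ler01 lexx.
by rewrite scale1r /direction addrC subrK.
Qed.

Lemma segment_vert (x y z : R) (i : nat) p :
  segment ((x, y), (x, z), i) p <-> p.1 = x /\ (y <= p.2 <= z \/ z <= p.2 <= y).
Proof.
rewrite segmentP /direction /source /target /=; split=> [[a ha ->]|].
  rewrite /= /GRing.scale /= subrr mulr0 addr0; split=> //.
  by have [h|/ltW h] := leP y z; [left|right]; nra.
case: p => p1 p2 /= [-> h].
have [yz|yz] := eqVneq y z.
  exists 0; first by rewrite lexx ler01.
  by rewrite scale0r addr0; congr pair; subst z; case: h; lra.
have d0 : z - y != 0 by rewrite subr_eq0 eq_sym.
exists ((p2 - y) / (z - y)); last first.
  rewrite [RHS]surjective_pairing /= /GRing.scale /= divfK //.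
  by congr pair; ring.
have [lt|lt|//] := ltgtP y z; first by rewrite ler_pdivlMr ?ler_pdivrMr; lra.
  by rewrite ler_ndivlMr ?ler_ndivrMr; lra.
by move/eqP: yz.
Qed.

Lemma segment_horiz (x y z : R) (i : nat) p :
  segment ((y, x), (z, x), i) p <-> p.2 = x /\ (y <= p.1 <= z \/ z <= p.1 <= y).
Proof.
have -> : segment ((y, x), (z, x), i) p = segment ((x, y), (x, z), i) (p.2, p.1).
  apply/propext; rewrite !segmentP /direction /source /target /=.
  case: p => p1 p2; split=> -[a ha [e1 e2]]; exists a => //; congr pair;
    by rewrite ?e1 ?e2.
exact: segment_vert.
Qed.

Lemma segment_conv e p q (a : R) : 0 <= a <= 1 ->
  segment e p -> segment e q -> segment e (p + a *: (q - p)).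
Proof.
move=> ha /segmentP[b hb ->] /segmentP[c hc ->]; apply/segmentP.
exists (b + a * (c - b)); first by nra.
rewrite opprD addrACA subrr add0r -scalerBl scalerA -addrA -scalerDl.
by [].
Qed.

Lemma segment_map t e :
  segment (map_arrow (app t) e) = app t @` segment e.
Proof.
have h a : app t (source e + a *: direction e) =
    source (map_arrow (app t) e) + a *: direction (map_arrow (app t) e).
  by rewrite app_conv /direction /source /target /= app_sub.
apply/seteqP; split=> p.
  move=> /segmentP[a ha ->]; exists (source e + a *: direction e); rewrite ?h //.
  by apply/segmentP; exists a.
by case=> q /segmentP[a ha ->] <-; apply/segmentP; exists a.
Qed.

Definition overlap e e' : Prop :=
  exists p q, [/\ p <> q, (segment e `&` segment e') p
                 & (segment e `&` segment e') q].

Lemma overlap_sym e e' : overlap e e' -> overlap e' e.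
Proof. by case=> p [q [pq [? ?] [? ?]]]; exists p, q. Qed.

Lemma overlap_sub e e' f f' : segment e `<=` segment f ->
  segment e' `<=` segment f' -> overlap e e' -> overlap f f'.
Proof.
by move=> h h' [p [q [pq [? ?] [? ?]]]]; exists p, q; split=> //; split; auto.
Qed.

Lemma overlap_map t e e' : 0 < ratio2 t ->
  overlap (map_arrow (app t) e) (map_arrow (app t) e') <-> overlap e e'.
Proof.
move=> h0; split; last first.
  move=> [p [q [pq [? ?] [? ?]]]]; exists (app t p), (app t q).
  rewrite !segment_map; split; first by move/(app_inj h0).
    by split; exists p.
  by split; exists q.
move=> [p [q []]]; rewrite !segment_map => pq [[p1 ? e1] [p2 p2s e2]].
move=> [[q1 ? e3] [q2 q2s e4]]; exists p1, q1.
move: e2 e4; rewrite -e1 -e3 => /(app_inj h0) e2 /(app_inj h0) e4; subst p2 q2.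
by split=> //; move=> e5; apply: pq; rewrite -e1 -e3 e5.
Qed.

(** Each source is reached from the other by a nonnegative multiple of the common displacement. The
    two multiples add up to zero, so both vanish. Thus plain equality of arrows can replace the
    three conditions in [arrow_compatible]. *)
Lemma segment_eq_arrow e e' : overlap e e' -> segment e = segment e' ->
  color e = color e' -> direction e = direction e' -> e = e'.
Proof.
move=> [p [q [pq [pe _] [qe _]]]] se ce de.
have d0 : direction e != 0.
  apply/eqP => d0; apply: pq.
  by case/segmentP: pe => a _ ->; case/segmentP: qe => b _ ->; rewrite d0 !scaler0.
have /segmentP[a /andP[a0 _] ea] : segment e (source e').
  by rewrite se; apply: segment_source.
have /segmentP[b /andP[b0 _] eb] : segment e' (source e).
  by rewrite -se; apply: segment_source.
have : (a + b) *: direction e = 0.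
  rewrite scalerDl; move: eb; rewrite ea -de -addrA => /eqP.
  by rewrite addrC -subr_eq subrr eq_sym => /eqP.
move/eqP; rewrite scaler_eq0 (negbTE d0) orbF paddr_eq0 // => /andP[/eqP a00 _].
have es : source e' = source e by rewrite ea a00 scale0r addr0.
have et : target e' = target e.
  by apply: (addIr (- source e')); rewrite -/(direction e') -de /direction es.
case: e e' es et ce {se de pe qe ea eb d0} => [[P Q] i] [[P' Q'] i'].
by rewrite /source /target /color /= => -> -> ->.
Qed.

End Segments.

(** * Continuity of placements, open and closed images *)

Section Topology.
Variable R : realType.
Implicit Types (p q v : R * R) (t : placement R).

Lemma fst_continuous : continuous (@fst R R).
Proof. by move=> p; exact: cvg_fst. Qed.

Lemma snd_continuous : continuous (@snd R R).
Proof. by move=> p; exact: cvg_snd. Qed.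

Lemma open_prod (A B : set R) : open A -> open B -> open (A `*` B).
Proof.
move=> oA oB; have -> : A `*` B = (@fst R R @^-1` A) `&` (@snd R R @^-1` B) by [].
by apply: openI; apply: open_comp => // p _;
  [apply: fst_continuous | apply: snd_continuous].
Qed.

Lemma closed_prod (A B : set R) : closed A -> closed B -> closed (A `*` B).
Proof.
move=> cA cB; have -> : A `*` B = (@fst R R @^-1` A) `&` (@snd R R @^-1` B) by [].
by apply: closedI; apply: preimage_closed => // p _;
  [apply: fst_continuous | apply: snd_continuous].
Qed.

Lemma affine_continuous (a b c a' b' c' : R) :
  continuous (fun p : R * R => (a + b * p.1 + c * p.2, a' + b' * p.1 + c' * p.2)).
Proof.
have h (x y z : R) : continuous (fun p : R * R => x + y * p.1 + z * p.2).
  move=> p; apply: cvgD; first apply: cvgD; first exact: cvg_cst.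
    by apply: cvgMr; exact: cvg_fst.
  by apply: cvgMr; exact: cvg_snd.
by move=> p; exact: (cvg_pair (h a b c p) (h a' b' c' p)).
Qed.

Lemma app_continuous t : continuous (app t).
Proof.
have -> : app t = fun p => ((origin t).1 + (axis t).1 * p.1
    + (- flip_sign t * (axis t).2) * p.2,
    (origin t).2 + (axis t).2 * p.1 + (flip_sign t * (axis t).1) * p.2).
  by apply/funext=> p; rewrite /app /lin [LHS]surjective_pairing /=;
    congr pair; ring.
exact: affine_continuous.
Qed.

Lemma unapp_continuous t : continuous (unapp t).
Proof.
set u := axis t; set o := origin t; set r := (ratio2 t)^-1; set f := flip_sign t.
have -> : unapp t = fun p => (- (u.1 * o.1 + u.2 * o.2) * r + (u.1 * r) * p.1
    + (u.2 * r) * p.2,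
    - f * (u.1 * o.2 - u.2 * o.1) * r + (- f * u.2 * r) * p.1 + (f * u.1 * r) * p.2).
  by apply/funext=> p; rewrite /unapp -/u -/o -/r -/f [LHS]surjective_pairing /=;
    congr pair; ring.
exact: affine_continuous.
Qed.

Lemma app_image_preimage t (A : set (R * R)) : 0 < ratio2 t ->
  app t @` A = unapp t @^-1` A.
Proof. by move=> h; apply/seteqP; split=> p; rewrite (app_image _ _ h). Qed.

Lemma open_app_image t (A : set (R * R)) : 0 < ratio2 t -> open A ->
  open (app t @` A).
Proof.
move=> h oA; rewrite app_image_preimage //.
by apply: open_comp => // p _; exact: unapp_continuous.
Qed.

Lemma closed_app_image t (A : set (R * R)) : 0 < ratio2 t -> closed A ->
  closed (app t @` A).
Proof.
move=> h oA; rewrite app_image_preimage //.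
by apply: preimage_closed => // p _; exact: unapp_continuous.
Qed.

Lemma open_preimage_app t (A : set (R * R)) : open A -> open (app t @^-1` A).
Proof. by move=> oA; apply: open_comp => // p _; exact: app_continuous. Qed.

Lemma open_ray (A : set (R * R)) p v : open A -> A p ->
  exists2 b : R, 0 < b & forall a, 0 <= a < b -> A (p + a *: v).
Proof.
move=> oA Ap; have /nbhs_ballP[r /= r0 hr] : nbhs p A by exact: open_nbhs_nbhs.
have n0 : 0 < `|v| + 1 by rewrite ltr_wpDl.
exists (r / (`|v| + 1)); first by rewrite divr_gt0.
move=> a /andP[a0]; rewrite ltr_pdivlMr // => ha; apply: hr.
rewrite -ball_normE /ball_ /= opprD addrA subrr add0r normrN normrZ ger0_norm //.
by apply: le_lt_trans ha; rewrite ler_wpM2l // lerDl.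
Qed.

End Topology.

Ltac psi_order R :=
  have [? ? ? ? [/andP[? ?] ?]] := psi_order R.

Ltac each_arrow :=
  rewrite ?inE; do ?[case/predU1P => [->|]]; try first [move/eqP => -> | move=> ->].

(** * The hexagon, its interior and its boundary *)

Section Bee.
Variable R : realType.
Local Notation s := (psi R).
Implicit Types (p q v : R * R) (e : arrow R).

(** The two rectangles overlap in a full rectangle, so the union of the open ones is already the
    whole interior. *)
Definition open_bee : set (R * R) :=
  (`]0, s[ `*` `]0, s ^+ 2[) `|` (`]0, s ^+ 3[ `*` `]0, 1[).

Lemma beeE p : bee R p <->
  (0 <= p.1 <= s /\ 0 <= p.2 <= s ^+ 2) \/ (0 <= p.1 <= s ^+ 3 /\ 0 <= p.2 <= 1).
Proof. by rewrite /bee /setU /= !in_itv /=. Qed.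

Lemma open_beeE p : open_bee p <->
  (0 < p.1 < s /\ 0 < p.2 < s ^+ 2) \/ (0 < p.1 < s ^+ 3 /\ 0 < p.2 < 1).
Proof. by rewrite /open_bee /setU /= !in_itv /=. Qed.

Lemma open_open_bee : open open_bee.
Proof. by apply: openU; apply: open_prod; apply: interval_open. Qed.

Lemma closed_bee : closed (bee R).
Proof. by apply: closedU; apply: closed_prod; apply: interval_closed. Qed.

Lemma open_bee_sub : open_bee `<=` bee R.
Proof. move=> p /open_beeE h; apply/beeE; case: h => h; [left|right]; lra. Qed.

Definition base_arrows (b : bool) : seq (arrow R) :=
  if b then large_arrows R else small_arrows R.

(* true when the tile lies to the left of the arrow *)
Definition base_sides (b : bool) : seq bool :=
  if b then [:: false; true; true; false; false;
                false; false; false; false; false]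
  else [:: false; false; false; false; true; false; false; false].

Definition sided_base_arrows b := zip (base_arrows b) (base_sides b).

Lemma arrow_boundary b e p : e \in base_arrows b -> segment e p ->
  bee R p /\ ~ open_bee p.
Proof.
move=> h hp; rewrite beeE open_beeE; psi_order R.
by move: h hp; case: b; rewrite /base_arrows; each_arrow;
  rewrite ?segment_vert ?segment_horiz => -[? [/andP[? ?]|/andP[? ?]]];
  split; lra.
Qed.

Lemma bee_boundary p : bee R p -> ~ open_bee p ->
  (p.1 = 0 /\ 0 <= p.2 <= 1) \/ (p.2 = 0 /\ 0 <= p.1 <= s) \/
  (p.1 = s /\ 0 <= p.2 <= s ^+ 2) \/ (p.2 = s ^+ 2 /\ s ^+ 3 <= p.1 <= s) \/
  (p.1 = s ^+ 3 /\ s ^+ 2 <= p.2 <= 1) \/ (p.2 = 1 /\ 0 <= p.1 <= s ^+ 3).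
Proof.
rewrite beeE open_beeE => h1 h2; psi_order R; lra.
Qed.
(** From every boundary point some direction leaves the hexagon at once. On the two sides at the
    reentrant corner this is the diagonal (1, 1), since at the corner itself neither axis direction
    leaves. *)
Lemma interior_bee : interior (bee R) `<=` open_bee.
Proof.
move=> p ip; have bp := interior_subset ip; apply: contrapT => np.
suff [v hv] : exists v, forall a, 0 < a -> ~ bee R (p + a *: v).
  have [b b0 hb] := open_ray v (open_interior _) ip.
  apply: (hv (b / 2)); first by rewrite divr_gt0.
  by apply: interior_subset; apply: hb; lra.
have := bee_boundary bp np; psi_order R.
case=> [[? ?]|[[? ?]|[[? ?]|[[? ?]|[[? ?]|[? ?]]]]]];
  [exists (-1, 0)|exists (0, -1)|exists (1, 0)|exists (1, 1)|exists (1, 1)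
  |exists (0, 1)]; move=> a a0 /beeE; rewrite /= /GRing.scale /=; lra.
Qed.

End Bee.
Arguments open_bee R : clear implicits.

Ltac hit n := exists n; [by [] | rewrite /= ?segment_vert ?segment_horiz /=; lra].

Section Tiles.
Variable R : realType.
Local Notation s := (psi R).
Implicit Types (p q v : R * R) (e : arrow R) (t h : placement R).

Lemma boundary_arrow b p : bee R p -> ~ open_bee R p ->
  exists2 e, e \in base_arrows R b & segment e p.
Proof.
move=> h1 h2; have h := bee_boundary h1 h2; psi_order R.
suff [i ib] : exists2 i, (i < size (base_arrows R b))%N &
    segment (nth ((0, 0), (0, 0), 0%N) (base_arrows R b) i) p.
  move=> hi; exists (nth ((0, 0), (0, 0), 0%N) (base_arrows R b) i) => //.
  exact: mem_nth.
move: {h1 h2} h; case: b => /=.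
- case=> [[x y]|[[y x]|[[x y]|[[y x]|[[x y]|[y x]]]]]].
  + have [?|?] := leP p.2 (s ^+ 4); first by hit 0%N.
    have [?|?] := leP p.2 (2 * s ^+ 4).
      by hit 1%N.
    by hit 2%N.
  + have [?|?] := leP p.1 (s ^+ 3); first by hit 4%N.
    by hit 3%N.
  + have [?|?] := leP p.2 (s ^+ 4); first by hit 6%N.
    by hit 5%N.
  + by hit 7%N.
  + by hit 8%N.
  + by hit 9%N.
- case=> [[x y]|[[y x]|[[x y]|[[y x]|[[x y]|[y x]]]]]].
  + have [?|?] := leP p.2 (s ^+ 4); first by hit 0%N.
    by hit 1%N.
  + have [?|?] := leP p.1 (s ^+ 3); first by hit 3%N.
    by hit 2%N.
  + by hit 4%N.
  + by hit 5%N.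
  + by hit 6%N.
  + by hit 7%N.
Qed.

Definition midpoint e : R * R := source e + (1 / 2) *: direction e.

Definition sideways (b : bool) e : R * R :=
  if b then (- (direction e).2, (direction e).1)
  else ((direction e).2, - (direction e).1).

(** By convexity: [x + a * w] divides the way from [x] to [x + 1 / 10 * w] in the proportion
    [10 * a]. *)
Lemma between_segment (x w L a : R) : 0 < a < 1 / 10 ->
  0 <= x <= L -> 0 < x + 1 / 10 * w < L -> 0 < x + a * w < L.
Proof.
move=> /andP[a0 a1] /andP[x0 xL] /andP[y0 yL].
have e : x + a * w = (1 - 10 * a) * x + 10 * a * (x + 1 / 10 * w) by field.
have h1 : 0 <= (1 - 10 * a) * x by apply: mulr_ge0; lra.
have h2 : 0 <= (1 - 10 * a) * (L - x) by apply: mulr_ge0; lra.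
have h3 : 0 < 10 * a * (x + 1 / 10 * w) by apply: mulr_gt0; lra.
have h4 : 0 < 10 * a * (L - (x + 1 / 10 * w)) by apply: mulr_gt0; lra.
by rewrite e; lra.
Qed.

(** This certifies the table [base_sides]. By [between_segment] it is enough to test the step
    [1 / 10], inside one of the two rectangles. *)
Lemma side_in_open_bee b (x : arrow R * bool) (a : R) :
  x \in sided_base_arrows R b -> 0 < a < 1 / 10 ->
  open_bee R (midpoint x.1 + a *: sideways x.2 x.1).
Proof.
move=> hx ha; set m := midpoint x.1; set w := sideways x.2 x.1.
suff : (0 <= m.1 <= s /\ 0 <= m.2 <= s ^+ 2) /\
       (0 < m.1 + 1 / 10 * w.1 < s /\ 0 < m.2 + 1 / 10 * w.2 < s ^+ 2) \/
       (0 <= m.1 <= s ^+ 3 /\ 0 <= m.2 <= 1) /\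
       (0 < m.1 + 1 / 10 * w.1 < s ^+ 3 /\ 0 < m.2 + 1 / 10 * w.2 < 1).
  rewrite open_beeE => -[[[? ?] [? ?]]|[[? ?] [? ?]]];
    [left|right]; split; exact: between_segment.
rewrite {}/m {}/w; clear a ha.
have s4 := psi4 R; have [? ? /andP[? ?] /andP[? ?]] := psi_bounds R.
move: hx; case: b => /=; each_arrow;
  rewrite /midpoint /sideways /direction /source /target /= /GRing.scale /= ?s4;
  (* The rectangle that contains the step, for the ten arrows of the large tile and then the eight
     of the small one. *)
  [> right | right | right | left | right | left | left | left | right | right
   | right | right | left | right | left | left | right | right];
  clear s4; split; split; lra.
Qed.

End Tiles.

Section PlacedTiles.
Variable R : realType.
Local Notation s := (psi R).
Implicit Types (p q v : R * R) (e : arrow R) (t h : placement R).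

Definition region t : set (R * R) := app t @` bee R.
Definition inner t : set (R * R) := app t @` open_bee R.
Definition arrows t : seq (arrow R) :=
  map (map_arrow (app t)) (base_arrows R (is_large t)).
(** A reflection exchanges left and right, hence the exclusive or with [flipped t]. *)
Definition sided_arrows t : seq (arrow R * bool) :=
  [seq (map_arrow (app t) x.1, x.2 (+) flipped t)
     | x <- sided_base_arrows R (is_large t)].

Lemma region_cmp t h : region (cmp t h) = app t @` region h.
Proof.
by rewrite /region image_comp; congr image; apply/funext=> p; rewrite /= app_cmp.
Qed.

Lemma inner_cmp t h : inner (cmp t h) = app t @` inner h.
Proof.
by rewrite /inner image_comp; congr image; apply/funext=> p; rewrite /= app_cmp.
Qed.

Lemma arrows_cmp t h : arrows (cmp t h) = map (map_arrow (app t)) (arrows h).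
Proof.
rewrite /arrows -map_comp; apply: eq_map => e.
by rewrite /= /map_arrow /source /target /= !app_cmp.
Qed.

Lemma direction_map t e :
  direction (map_arrow (app t) e) = lin t (direction e).
Proof. exact: app_sub. Qed.

Lemma sideways_map t (b : bool) e :
  sideways (b (+) flipped t) (map_arrow (app t) e) = lin t (sideways b e).
Proof.
rewrite /sideways direction_map.
rewrite /lin /flip_sign.
by case: b; case: (flipped t) => /=; congr pair; rewrite ?expr0 ?expr1; ring.
Qed.

Lemma midpoint_map t e : midpoint (map_arrow (app t) e) = app t (midpoint e).
Proof. by rewrite /midpoint app_conv -app_sub. Qed.

Lemma sided_arrows_side t (x : arrow R * bool) (a : R) :
  x \in sided_arrows t -> 0 < a < 1 / 10 ->
  inner t (midpoint x.1 + a *: sideways x.2 x.1).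
Proof.
move=> /mapP[y yb ->] ha; rewrite /= midpoint_map sideways_map -app_conv.
by eexists; first exact: side_in_open_bee yb ha.
Qed.

Lemma sided_arrowsP t e :
  reflect (exists b, (e, b) \in sided_arrows t) (e \in arrows t).
Proof.
have sz : size (base_arrows R (is_large t)) = size (base_sides (is_large t)).
  by case: (is_large t).
have <- : map fst (sided_arrows t) = arrows t.
  rewrite /sided_arrows -map_comp /arrows -(@unzip1_zip _ _ (base_arrows R _)
    (base_sides (is_large t))) ?sz // -map_comp.
  exact: eq_map.
apply: (iffP mapP) => [[[e' b] h /= ->]|[b h]]; first by exists b.
by exists (e, b).
Qed.

Section Nondegenerate.
Variable t : placement R.
Hypothesis t0 : 0 < ratio2 t.

Lemma open_inner : open (inner t).
Proof. by apply: open_app_image => //; apply: open_open_bee. Qed.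

Lemma closed_region : closed (region t).
Proof. by apply: closed_app_image => //; apply: closed_bee. Qed.

Lemma inner_sub : inner t `<=` region t.
Proof. exact/image_subset/open_bee_sub. Qed.

Lemma region_meets (U : set (R * R)) p : open U -> U p -> region t p ->
  exists2 q, U q & inner t q.
Proof.
move=> oU Up [p0 /beeE bp ep]; subst p.
(* This point lies in both open rectangles, so from any point of the hexagon the way towards it
   enters the interior at once. *)
pose c : R * R := (s ^+ 3 / 2, s ^+ 2 / 2); psi_order R.
have [b b0 hb] := open_ray (c - p0) (open_preimage_app (t := t) oU) Up.
have [a /andP[a0 a1] ab] : exists2 a, 0 < a <= 1 & a < b.
  exists (Num.min 1 (b / 2)); first by rewrite lt_min ge_min lexx; lra.
  by rewrite gt_min; apply/orP; right; lra.
exists (app t (p0 + a *: (c - p0))); first by apply: hb; rewrite (ltW a0).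
exists (p0 + a *: (c - p0)) => //; apply/open_beeE.
have conv (x y z : R) : 0 <= x <= z -> 0 < y < z -> 0 < x + a * (y - x) < z.
  move=> /andP[x0 xz] /andP[y0 yz]; have [->|a1'] := eqVneq a 1; first lra.
  have : 0 < 1 - a by rewrite subr_gt0 lt_neqAle a1'.
  by move=> ?; apply/andP; split; nra.
by case: bp => -[hx hy]; [left|right]; split; apply: conv => //=; lra.
Qed.

Lemma interior_region : interior (region t) = inner t.
Proof.
apply/seteqP; split=> [p ip|]; last first.
  by rewrite -open_subsetE; [exact: inner_sub | exact: open_inner].
have [q bq eq] := interior_subset ip; exists q => //; apply: interior_bee.
have iA : interior (app t @^-1` interior (region t)) q.
  have /interior_id -> := open_preimage_app (t := t) (open_interior (region t)).
  by rewrite /= eq.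
apply: interiorS iA => r /= /interior_subset [r' br' /(app_inj t0) <-] //.
Qed.

End Nondegenerate.
End PlacedTiles.

(** * Disjointness and local finiteness *)

Section PlaneTilings.
Variable R : realType.
Local Notation s := (psi R).
Implicit Types (p q v : R * R) (e : arrow R) (t h : placement R).
Implicit Types P : set (placement R).

Definition apart t t' : Prop := forall p, inner t p -> ~ inner t' p.

Definition compatible t t' : Prop := forall e e',
  e \in arrows t -> e' \in arrows t' -> overlap e e' -> e = e'.

Lemma apart_region t t' p : 0 < ratio2 t' -> apart t t' ->
  region t p -> ~ inner t' p.
Proof.
move=> t'0 h rp ip.
by have [q /h] := region_meets (open_inner t'0) ip rp.
Qed.

Lemma finite_subsingleton (T : Type) (A : set T) :
  (forall x y, A x -> A y -> x = y) -> finite_set A.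
Proof.
move=> h; have [[x Ax]|/forallNP A0] := pselect (exists x, A x).
  by rewrite (_ : A = [set x]); [exact: finite_set1|apply/seteqP; split=> y;
    [by move=> Ay; exact: h|move=> ->]].
by rewrite (_ : A = set0); [exact: finite_set0|apply/seteqP; split=> y // /A0].
Qed.

Lemma sqr_sum_bound (x y b : R) : 0 <= b -> x ^+ 2 + y ^+ 2 <= b ^+ 2 ->
  `|x| <= b /\ `|y| <= b.
Proof.
move=> b0 h; have hx := sqr_ge0 x; have hy := sqr_ge0 y.
by split; rewrite -ler_sqr ?nnegrE // real_normK ?num_real //; lra.
Qed.

Lemma bee_unit p : bee R p -> 0 <= p.1 <= 1 /\ 0 <= p.2 <= 1.
Proof. by move=> /beeE h; psi_order R; case: h; lra. Qed.

Lemma app_dist t p q (r : R) : 0 <= r -> ratio2 t <= r ^+ 2 ->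
  bee R p -> bee R q ->
  `|(app t p).1 - (app t q).1| <= 2 * r /\ `|(app t p).2 - (app t q).2| <= 2 * r.
Proof.
move=> r0 hr /bee_unit [p1 p2] /bee_unit [q1 q2].
have := app_sub t p q; move=> /[dup] /(congr1 fst) /= -> /(congr1 snd) /= ->.
apply: sqr_sum_bound; first lra.
rewrite [X in X <= _](lin_norm t (p - q)) exprMn /=.
rewrite [X in _ <= X]mulrC ler_pM ?addr_ge0 ?sqr_ge0 //; nra.
Qed.

(* Every tile contains a point of a sufficiently fine square grid in its
   interior, and different tiles contain different ones. *)
Lemma locally_finite P (r r' K : R) : 0 < r ->
  (forall t, P t -> r ^+ 2 <= ratio2 t <= r' ^+ 2) -> 0 <= r' ->
  (forall t t', P t -> P t' -> t <> t' -> apart t t') ->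
  finite_set [set t | P t /\ exists2 p, region t p & `|p| <= K].
Proof.
(* Rounding down to the grid moves a point by at most [d] in each coordinate. In the coordinates of
   a tile this is a distance below 1/5, while [c] is farther than that from the boundary of the
   vertical rectangle, as [s ^+ 3 / 2] exceeds 9/40. *)
move=> r0 hr r'0 hP; pose d := r / 10.
have d0 : 0 < d by rewrite divr_gt0.
pose g (ij : int * int) : R * R := (d * ij.1%:~R, d * ij.2%:~R).
pose N := Num.trunc ((K + 2 * r') / d + 1).
pose B : set int := [set i | `|i| <= N.+1%:Z].
have fB : finite_set B.
  have -> : B = [set (k%:Z - N.+1%:Z) | k in `I_(N.+1.*2.+1)].
    apply/seteqP; split=> i; rewrite /B /=; last by case=> k; lia.
    by move=> hi; exists (absz (i + N.+1%:Z)); rewrite /=; lia.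
  exact/finite_image/finite_II.
apply: (@sub_finite_set _ _ (\bigcup_(ij in B `*` B) [set t | P t /\ inner t (g ij)])); last first.
  apply: bigcup_finite => [|ij _]; first exact: finite_setX.
  apply: finite_subsingleton => t t' [Pt it] [Pt' it'].
  by apply: contrapT => /(hP _ _ Pt Pt') /(_ _ it).
move=> t [Pt [p [p0 bp0 ep] pK]]; have /andP[tr tr'] := hr t Pt.
have t0 : 0 < ratio2 t by apply: lt_le_trans tr; rewrite exprn_gt0.
pose c : R * R := (s ^+ 3 / 2, 1 / 2); pose z := app t c.
pose ij := (Num.floor (z.1 / d), Num.floor (z.2 / d)).
have bc : bee R c by apply/beeE; right; psi_order R; rewrite /=; lra.
have gz (x : R) : 0 <= x - d * (Num.floor (x / d))%:~R <= d.
  have := floor_itv (x / d); rewrite intrD ler_pdivlMr // ltr_pdivrMr //.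
  lra.
have bz (x : R) : `|x| <= K + 2 * r' -> B (Num.floor (x / d)).
  move=> hx; have hy : `|x / d| <= (K + 2 * r') / d.
    by rewrite normrM normfV (gtr0_norm d0) ler_pM2r // invr_gt0.
  have Y0 : 0 <= (K + 2 * r') / d + 1 by rewrite addr_ge0 ?(le_trans _ hy).
  have /andP[_ hN] := truncn_itv Y0; rewrite -/N in hN.
  rewrite /B /= -(ler_int R) intr_norm; apply: le_trans (ltW hN).
  have := floor_itv (x / d); rewrite intrD; move: hy; rewrite !ler_norml; lra.
have [h1 h2] := app_dist r'0 tr' bc bp0.
exists ij; last split=> //.
  move: pK h1 h2; rewrite -ep -/z prod_normE ge_max => /andP[].
  by rewrite !ler_norml => *; split; apply: bz; rewrite ler_norml; lra.
rewrite /inner app_image //; set w := unapp t (g ij).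
have ew : app t w = g ij by rewrite unappK.
have := lin_norm t (c - w); rewrite -app_sub ew -/z.
have := gz z.1; have := gz z.2; rewrite /= => g2 g1 e.
have [w1 w2] : `|c.1 - w.1| <= 1 / 5 /\ `|c.2 - w.2| <= 1 / 5.
  apply: sqr_sum_bound; first lra.
  rewrite -(ler_pM2l t0) -e; apply: (@le_trans _ _ (2 * d ^+ 2)).
    by rewrite /d in g1 g2 *; nra.
  apply: (@le_trans _ _ (r ^+ 2 * (1 / 5) ^+ 2)); last by rewrite ler_pM2r.
  rewrite /d expr_div_n; have : 0 < r ^+ 2 by rewrite exprn_gt0.
  lra.
apply/open_beeE; right; have [_ _ _ /andP[? ?]] := psi_bounds R.
move: w1 w2; rewrite /c /= !ler_norml; lra.
Qed.

End PlaneTilings.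

(** * Every arrow is shared with a neighboring tile *)

Section Partners.
Variable R : realType.
Implicit Types (p q v : R * R) (e : arrow R) (t h : placement R).
Implicit Types P : set (placement R).

(* The ratios are bounded only in order to have local finiteness. *)
Definition plane_tiling P (r r' : R) : Prop :=
  [/\ 0 < r <= r', (forall t, P t -> r ^+ 2 <= ratio2 t <= r' ^+ 2),
      (forall t t', P t -> P t' -> t <> t' -> apart t t')
    & forall p, exists2 t, P t & region t p].

Lemma infinite_segment e : direction e != 0 -> infinite_set (segment e).
Proof.
move=> d0 fin; apply: infinite_nat.
pose g (n : nat) := source e + n.+1%:R^-1 *: direction e.
have -> : [set: nat] = g @^-1` segment e.
  apply/seteqP; split=> // n _; apply/segmentP; exists n.+1%:R^-1 => //.
  by rewrite invr_ge0 ler0n /= invf_le1 ?ltr0n // ler1n.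
apply: finite_preimage fin => m n _ _ /addrI /eqP.
rewrite -subr_eq0 -scalerBl scaler_eq0 (negbTE d0) orbF subr_eq0 => /eqP.
by move/invr_inj/eqP; rewrite eqr_nat eqSS => /eqP.
Qed.

Lemma arrow_in_region t e p : 0 < ratio2 t -> e \in arrows t -> segment e p ->
  region t p /\ ~ inner t p.
Proof.
move=> t0 /mapP[e0 h ->]; rewrite segment_map => -[q qe <-].
have [bq nbq] := arrow_boundary h qe; split; first by exists q.
by move=> [q' ? /(app_inj t0) eq]; apply: nbq; rewrite -eq.
Qed.

Lemma region_arrow t p : region t p -> ~ inner t p ->
  exists2 e, e \in arrows t & segment e p.
Proof.
move=> [q bq <-] nb.
have [|e eb eq] := @boundary_arrow _ (is_large t) q bq.
  by move=> ?; apply: nb; exists q.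
exists (map_arrow (app t) e); first exact: map_f.
by rewrite segment_map; exists q.
Qed.

(** Every point of [e] lies on an arrow of another tile, and only finitely many tiles are near. If
    no other tile had the arrow [e], then by assumption each of these arrows would meet [e] in at
    most one point, and the segment of [e] would be finite. *)
Lemma partner P r r' t e : plane_tiling P r r' -> P t -> e \in arrows t ->
  direction e != 0 ->
  (forall t' e', P t' -> t' <> t -> e' \in arrows t' -> overlap e e' -> e = e') ->
  exists t', [/\ P t', t' <> t & e \in arrows t'].
Proof.
move=> [/andP[r0 rr'] hr hP cov] Pt et d0 he.
have pos t' : P t' -> 0 < ratio2 t'.
  by move=> /hr /andP[h _]; apply: lt_le_trans h; rewrite exprn_gt0.
have r'0 : 0 <= r' by apply: le_trans rr'; exact: ltW.
apply: contrapT => /forallNP no; apply: (infinite_segment d0).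
(* Points of [e] have norm at most [K - 1], so a ball of radius 1 around one of them meets no tiles
   besides [t] and those of [N]. *)
pose K := `|source e| + `|direction e| + 1.
pose N := [set t' | (P t' /\ exists2 p, region t' p & `|p| <= K) /\ t' <> t].
have fN : finite_set N.
  by apply: sub_finite_set (locally_finite K r0 hr r'0 hP) => t' [].
have norm_seg p : segment e p -> `|p| <= K - 1.
  move=> /segmentP[a /andP[a0 a1] ->]; rewrite addrK.
  apply: le_trans (ler_normD _ _) _; rewrite lerD2l normrZ ger0_norm //.
  by rewrite ler_piMl.
apply: (@sub_finite_set _ _
  (\bigcup_(t' in N) \bigcup_(e' in [set` arrows t'])
    (segment e `&` segment e'))); last first.
  apply: bigcup_finite => // t' [[Pt' _] nt']; apply: bigcup_finite => // e' /= he'.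
  apply: finite_subsingleton => p q pp qq; apply: contrapT => pq.
  have ee' : e = e' by apply: he he' _ => //; exists p, q.
  by apply: (no t'); split=> //; rewrite ee'.
move=> p ep; have [rp ip] := arrow_in_region (pos _ Pt) et ep.
suff [t' [Nt' rt']] : exists t', N t' /\ region t' p.
  have [[Pt' _] nt'] := Nt'.
  have ip' := apart_region (pos _ Pt') (hP _ _ Pt Pt' (nesym nt')) rp.
  by have [e' ? ?] := region_arrow rt' ip'; exists t' => //; exists e'.
apply: contrapT => /forallNP noN; apply: ip.
rewrite -interior_region; last exact: pos.
(* A finite union of closed tiles is closed. A point of [e] outside it would have a neighborhood
   covered by [t] alone and would be interior to [t]. *)
pose C := \bigcup_(t' in N) region t'.
have cC : closed C.
  by apply: closed_bigcup => // t' [[Pt' _] _]; apply: closed_region; exact: pos.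
have oU : open (~` C `&` ball p 1) by apply: openI; [exact: closed_openC | exact: ball_open].
apply: (interiorS (A := ~` C `&` ball p 1)); last first.
  rewrite (interior_id _).1 //; split; last exact: ballxx.
  by move=> [t' Nt' rt']; apply: (noN t').
move=> q [nC]; rewrite -ball_normE /ball_ /= => qp.
have [t' Pt' rt'] := cov q; have [<- //|tt'] := pselect (t' = t).
case: nC; exists t' => //; split=> //; split=> //; exists q => //.
have -> : q = p - (p - q) by rewrite subKr.
apply: le_trans (ler_normB _ _) _.
by move: (norm_seg p ep) qp; lra.
Qed.

End Partners.

(** * The conserved quantity *)

Section Weights.
Variable R : realType.
Local Notation s := (psi R).
Implicit Types (p q v : R * R) (e : arrow R) (t h : placement R).
Implicit Types (x : arrow R * bool).

Definition other_side x : arrow R * bool := (x.1, ~~ x.2).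

Lemma other_sideK : involutive other_side.
Proof. by case=> e b; rewrite /other_side /= negbK. Qed.

(** Both interiors contain the points close to the midpoint of the arrow on that side. *)
Lemma same_side_not_apart t t' x :
  x \in sided_arrows t -> x \in sided_arrows t' -> ~ apart t t'.
Proof.
have a0 : 0 < (1 / 20 : R) < 1 / 10 by lra.
move=> h h'; apply; first exact: (sided_arrows_side h a0).
exact: (sided_arrows_side h' a0).
Qed.

(** Otherwise the interior point beside the midpoint would be the midpoint itself, which lies on the
    boundary. *)
Lemma arrow_direction_neq0 t e : 0 < ratio2 t -> e \in arrows t ->
  direction e != 0.
Proof.
move=> t0 et; apply/eqP => d0; have /sided_arrowsP [b eb] := et.
have a0 : 0 < (1 / 20 : R) < 1 / 10 by lra.
have z : sideways b e = 0.
  by rewrite /sideways d0; case: (b : bool); congr pair; exact: oppr0.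
have : inner t (midpoint e + (1 / 20) *: sideways b e).
  exact: (sided_arrows_side eb a0).
rewrite z scaler0 addr0; apply: (arrow_in_region t0 et _).2.
by apply/segmentP; exists (1 / 2) => //; lra.
Qed.

Lemma uniq_base_arrows b : uniq (base_arrows R b).
Proof.
have h : [/\ 0 < s ^+ 3, s ^+ 3 < s ^+ 2, s ^+ 2 < s, s < 1 & 0 < s ^+ 4 < 1 / 2].
  by psi_order R; split; lra.
case: h => ? ? ? ? /andP[? ?].
by case: b; rewrite /= !inE !negb_or; do ?[apply/andP; split] => //;
  apply/eqP => -[*]; first [discriminate | lra].
Qed.

Lemma uniq_sided_arrows t : 0 < ratio2 t -> uniq (sided_arrows t).
Proof.
move=> t0; rewrite map_inj_in_uniq.
  exact/zip_uniql/uniq_base_arrows.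
move=> [[[p q] i] b] [[[p' q'] i'] b'] _ _ eq.
have /(app_inj t0) -> : app t p = app t p' := congr1 (fun z => z.1.1.1) eq.
have /(app_inj t0) -> : app t q = app t q' := congr1 (fun z => z.1.1.2) eq.
have /= -> := congr1 (fun z => z.1.2) eq.
by have /addIb -> : b (+) flipped t = b' (+) flipped t := congr1 snd eq.
Qed.

Definition square_norm p : R := p.1 ^+ 2 + p.2 ^+ 2.

Definition weight (d : R) x : R := (-1) ^+ x.2 *
  (if color x.1 == 3%N then square_norm (target x.1) - square_norm (source x.1)
   else if color x.1 == 6%N then (3 * s ^+ 2 - 2) * d ^+ 2 else 0).

Lemma weight_other_side d x : weight d (other_side x) = - weight d x.
Proof. by case: x => e [] /=; rewrite /weight /= ?expr0 ?expr1; ring. Qed.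

Definition d_placement d t : Prop :=
  ratio2 t = (if is_large t then 1 else s ^+ 2) * d ^+ 2.

(** A translation by v changes the weight of a color 3 arrow from P to Q by 2 v.(Q - P), up to the
    sign of the side, and the signed displacements of the two color 3 arrows of a tile cancel. So
    the position does not matter. In a large tile the color 3 weights cancel, and its two color 6
    arrows have the tile on different sides. In a small tile color 3 leaves (4 - 6 psi^2) d^2, up to
    the sign of the flip, and the two color 6 arrows, which have the tile on the same side,
    compensate this. That is the origin of 3 psi^2 - 2. *)
Lemma sum_weight d t : d_placement d t ->
  \sum_(x <- sided_arrows t) weight d x = 0.
Proof.
move=> dt; rewrite big_map.
under eq_bigr => x _ do rewrite /weight /= signr_addb mulrC mulrA.
rewrite -mulr_suml; apply/eqP; rewrite mulf_eq0; apply/orP; left; apply/eqP.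
have ht := flip_sign_sqr t; have hs := psi4 R; move: dt.
rewrite /d_placement /sided_base_arrows /ratio2; case: (is_large t) => dt.
  rewrite !big_cons big_nil /= /square_norm /app /lin /=.
  move: (flip_sign t) ht => f ht; ring: ht hs.
rewrite !big_cons big_nil /= /square_norm /app /lin /=.
have hr : (axis t).1 ^+ 2 = s ^+ 2 * d ^+ 2 - (axis t).2 ^+ 2 by rewrite -dt; ring.
move: (flip_sign t) ht => f ht; ring: ht hs hr.
Qed.

End Weights.

(** * Finite modifications cannot remove unmatched weight *)

Section Obstruction.
Variable R : realType.
Implicit Types (p q v : R * R) (e : arrow R) (t h : placement R).
Implicit Types (x : arrow R * bool) (P : set (placement R)).

Definition in_tiling P x : Prop := exists2 t, P t & x \in sided_arrows t.

Lemma in_tiling_unique P r r' t t' x : plane_tiling P r r' -> P t -> P t' ->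
  x \in sided_arrows t -> x \in sided_arrows t' -> t = t'.
Proof.
move=> [_ _ hP _] Pt Pt' xt xt'; apply: contrapT => /(hP _ _ Pt Pt').
exact: same_side_not_apart xt xt'.
Qed.

Lemma plane_tiling_ratio P r r' t : plane_tiling P r r' -> P t -> 0 < ratio2 t.
Proof.
move=> [/andP[r0 _] hr _ _] /hr /andP[h _].
by apply: lt_le_trans h; rewrite exprn_gt0.
Qed.

(** The tile found by [partner] must lie on the other side, as two different tiles on the same side
    of an arrow would overlap. *)
Lemma partner_side P r r' t x : plane_tiling P r r' -> P t ->
  x \in sided_arrows t ->
  (forall t' e', P t' -> t' <> t -> e' \in arrows t' -> overlap x.1 e' ->
    x.1 = e') ->
  in_tiling P (other_side x).
Proof.
move=> hP Pt xt hx; have t0 := plane_tiling_ratio hP Pt.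
have et : x.1 \in arrows t.
  by apply/sided_arrowsP; exists x.2; rewrite -surjective_pairing.
have [t' [Pt' nt /sided_arrowsP[b hb]]] :=
  partner hP Pt et (arrow_direction_neq0 t0 et) hx.
exists t' => //; suff <- : (x.1, b) = other_side x by [].
rewrite /other_side; have [->//|eb] := eqVneq b (~~ x.2).
case: nt; apply: in_tiling_unique hP Pt' Pt hb _.
by move: eb; case: x {hx et} xt => [e []]; case: b => //=.
Qed.

Lemma compatible_in_tiling P r r' x : plane_tiling P r r' ->
  (forall t t', P t -> P t' -> t <> t' -> compatible t t') ->
  in_tiling P x -> in_tiling P (other_side x).
Proof.
move=> hP cP [t Pt xt]; apply: partner_side (hP) (Pt) (xt) _ => t' e' Pt' nt et' o.
apply: (cP _ _ Pt Pt' (nesym nt)) => //.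
by apply/sided_arrowsP; exists x.2; rewrite -surjective_pairing.
Qed.

(** An interior point of a tile in [P'] but not in [P] lies in some tile of [P], which cannot belong
    to [P']. So the tile meets one of finitely many tiles, and local finiteness applies. *)
Lemma finite_difference P P' r r' : plane_tiling P r r' ->
  plane_tiling P' r r' -> finite_set (P `\` P') -> finite_set (P' `\` P).
Proof.
move=> hP hP' /finite_seqP[l el]; have [/andP[r0 rr'] hr hdP cP] := hP.
have [_ hr' hdP' _] := hP'.
have r'0 : 0 <= r' by apply: le_trans rr'; exact: ltW.
pose K := \sum_(t <- l) (`|app t 0| + 2 * r').
apply: (@sub_finite_set _ _ _ _ (locally_finite K r0 hr' r'0 hdP')).
move=> t' [Pt' nt']; split=> //.
have ic : open_bee R (psi R ^+ 3 / 2, 1 / 2).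
  by apply/open_beeE; right; psi_order R; rewrite /=; lra.
pose c := app t' (psi R ^+ 3 / 2, 1 / 2).
have itc : inner t' c by eexists; first exact: ic.
exists c; first exact: inner_sub.
have [t Pt rt] := cP c.
have [P't|nP't] := pselect (P' t).
  have [tt'|tt'] := pselect (t = t'); first by case: nt'; rewrite -tt'.
  by case: (apart_region (plane_tiling_ratio hP' Pt') (hdP' _ _ P't Pt' tt') rt itc).
have tl : t \in l.
  by have : (P `\` P') t by []; rewrite el.
apply: (@le_trans _ _ (`|app t 0| + 2 * r')).
  have [q bq <-] := rt.
  have b0 : bee R 0 by apply/beeE; left; psi_order R; rewrite /=; lra.
  have /andP[_ hr2] := hr t Pt.
  have [h1 h2] := app_dist r'0 hr2 bq b0.
  have -> : app t q = app t 0 + (app t q - app t 0) by rewrite addrC subrK.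
  apply: le_trans (ler_normD _ _) _; rewrite lerD2l prod_normE ge_max.
  by rewrite h1 h2.
rewrite /K (big_rem t) //= lerDl sumr_ge0 // => u _.
by rewrite addr_ge0 // mulr_ge0.
Qed.

(** The infinitely many common tiles are removed before anything is summed: they contribute the same
    sided arrows to [P] and to [P']. What is left is an identity between indicator functions of
    finite lists, which is summed against the weight, an odd function under [other_side]. *)
Theorem unmatched_weight P P' r r' d (D : seq (arrow R * bool)) :
  plane_tiling P r r' -> plane_tiling P' r r' ->
  (forall t, P t -> d_placement d t) -> (forall t, P' t -> d_placement d t) ->
  (forall t t', P' t -> P' t' -> t <> t' -> compatible t t') ->
  uniq D ->
  (forall x, x \in D -> in_tiling P x /\ ~ in_tiling P (other_side x)) ->
  (forall x, x \notin D -> in_tiling P x -> in_tiling P (other_side x)) ->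
  finite_set (P `\` P') -> \sum_(x <- D) weight d x = 0.
Proof.
move=> hP hP' dP dP' cP' uD hD hnD fF.
pose sides (l : seq (placement R)) := flatten (map (@sided_arrows R) l).
have sum0 (l : seq (placement R)) : (forall t, t \in l -> d_placement d t) ->
    \sum_(x <- sides l) weight d x = 0.
  move=> hl; rewrite big_flatten big_map big_seq big1 // => t /hl.
  exact: sum_weight.
(* A sided arrow belongs to at most one tile of [Q], so it comes either from the finite difference
   or from a common tile, never from both. *)
have key Q Q' : plane_tiling Q r r' -> finite_set (Q `\` Q') ->
    exists l, [/\ [set` l] = Q `\` Q', uniq (sides l) & forall x,
      (in_tiling Q x <-> x \in sides l \/ in_tiling (Q `&` Q') x) /\
      ~ (x \in sides l /\ in_tiling (Q `&` Q') x)].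
  move=> hQ /finite_seqP[l0 el]; pose l := undup l0.
  have lQ t : t \in l <-> (Q `\` Q') t by rewrite mem_undup el.
  exists l; split.
  - by apply/seteqP; split=> t /= /lQ.
  - have : {subset l <= Q} by move=> t /lQ[Qt _]; rewrite inE.
    have : uniq l by exact: undup_uniq.
    elim: {lQ}l => [//|t l IH] /= /andP[tl ul] sub.
    have Qt : Q t by have := sub t (mem_head _ _); rewrite inE.
    have subl : {subset l <= Q} by move=> u ul'; apply: sub; rewrite in_cons ul' orbT.
    rewrite /sides /= cat_uniq uniq_sided_arrows; last exact: plane_tiling_ratio hQ Qt.
    rewrite IH // andbT /=; apply/hasPn => y /flatten_mapP[u ul' yu]; apply/negP => yt.
    have Qu : Q u by have := subl u ul'; rewrite inE.
    by move: tl; rewrite (in_tiling_unique hQ Qt Qu yt yu) ul'.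
  - move=> x; split; last first.
      move=> [/flatten_mapP[t /lQ[Qt nt] xt] [u [Qu Q'u] xu]].
      by apply: nt; rewrite (in_tiling_unique hQ Qt Qu xt xu).
    split=> [[t Qt xt]|[/flatten_mapP[t /lQ[Qt _] xt]|[t [Qt _] xt]]];
      [|by exists t|by exists t].
    have [Q't|nQ't] := pselect (Q' t); first by right; exists t.
    by left; apply/flatten_mapP; exists t => //; apply/lQ.
have [l [el ul hl]] := key _ _ hP fF.
have [l' [el' ul' hl']] := key _ _ hP' (finite_difference hP hP' fF).
have PP' : P `&` P' = P' `&` P := setIC _ _.
pose I (b : bool) : R := b%:R.
(* The indicators of [sides l] and [sides l'] differ by those of [P] and [P'], the common part
   dropping out. Antisymmetrized in the side, the indicator of [P'] vanishes and that of [P] becomes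
   the one of [D]. *)
have id x : I (x \in sides l) - I (other_side x \in sides l)
    - I (x \in sides l') + I (other_side x \in sides l')
    - I (x \in D) + I (other_side x \in D) = 0.
  pose n y := `[< in_tiling (P `&` P') y >].
  have cnt (m : seq (arrow R * bool)) Q y : (in_tiling Q y <->
      y \in m \/ in_tiling (P `&` P') y) /\
      ~ (y \in m /\ in_tiling (P `&` P') y) ->
      I (y \in m) + I (n y) = I `[< in_tiling Q y >].
    have T : true by []; have F : ~ false by [].
    rewrite /n /I => -[]; case: (y \in m); case: asboolP => hN; case: asboolP => hQ h1 h2;
      by [rewrite ?addr0 ?add0r | exfalso; clear -T F hN hQ h1 h2; tauto].
  have e1 := cnt _ _ _ (hl x); have e2 := cnt _ _ _ (hl (other_side x)).
  rewrite -PP' in hl'.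
  have e3 := cnt _ _ _ (hl' x); have e4 := cnt _ _ _ (hl' (other_side x)).
  have e5 : `[< in_tiling P' x >] = `[< in_tiling P' (other_side x) >].
    apply/asbool_equiv_eq; split=> /(compatible_in_tiling hP' cP') //.
    by rewrite other_sideK.
  have e6 : I `[< in_tiling P x >] - I `[< in_tiling P (other_side x) >]
      = I (x \in D) - I (other_side x \in D).
    have [xD|xD] := boolP (x \in D).
      have [h1 h2] := hD x xD; have [/hD|_] := boolP (other_side x \in D).
        by rewrite other_sideK => -[].
      by rewrite (asboolT h1) (asboolF h2).
    have [yD|yD] := boolP (other_side x \in D).
      have [h1 h2] := hD _ yD; rewrite other_sideK in h2.
      by rewrite (asboolT h1) (asboolF h2).
    rewrite (_ : `[< in_tiling P x >] = `[< in_tiling P (other_side x) >]) ?subrr //.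
    apply/asbool_equiv_eq; split=> [/(hnD _ xD)//|/(hnD _ yD)].
    by rewrite other_sideK.
  move: e1 e2 e3 e4 e6; rewrite e5; lra.
(* A finite range of summation stable under [other_side]. Reindexing by it turns each sum with
   [other_side x] into the negative of the one with [x], so that [id] yields twice the desired
   relation. *)
pose U0 := sides l ++ sides l' ++ D.
pose U := undup (U0 ++ map (@other_side R) U0).
have mo y (m : seq (arrow R * bool)) :
    (y \in map (@other_side R) m) = (other_side y \in m).
  by rewrite -{1}(other_sideK y) (mem_map (inv_inj (@other_sideK R))).
have uU : uniq U by exact: undup_uniq.
have pU : perm_eq U (map (@other_side R) U).
  apply: uniq_perm => //; first by rewrite map_inj_uniq //; exact: inv_inj (@other_sideK R).
  by move=> x; rewrite mo !mem_undup !(mem_cat _ U0) !mo other_sideK orbC.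
have sumI (m : seq (arrow R * bool)) : uniq m -> {subset m <= U0} ->
    \sum_(x <- U) weight d x * I (x \in m) = \sum_(x <- m) weight d x.
  move=> um sub; rewrite (eq_bigr (fun x => if x \in m then weight d x else 0)).
    rewrite -big_mkcond -big_filter; apply: perm_big.
    apply: uniq_perm => //; first exact: filter_uniq.
    move=> x; rewrite mem_filter mem_undup mem_cat; apply: andb_idr => /sub.
    by move=> ->.
  by move=> x _; rewrite /I; case: ifP => _; rewrite ?mulr1 ?mulr0.
have sumI' (m : seq (arrow R * bool)) : uniq m -> {subset m <= U0} ->
    \sum_(x <- U) weight d x * I (other_side x \in m) = - \sum_(x <- m) weight d x.
  move=> um sub; rewrite (perm_big _ pU) big_map -sumI // -sumrN.
  by apply: eq_bigr => x _; rewrite other_sideK weight_other_side mulNr.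
have : \sum_(x <- U) weight d x * (I (x \in sides l) - I (other_side x \in sides l)
    - I (x \in sides l') + I (other_side x \in sides l')
    - I (x \in D) + I (other_side x \in D)) = 0.
  by rewrite big1 // => x _; rewrite id mulr0.
under eq_bigr => x _ do rewrite !(mulrDr, mulrN).
rewrite !big_split /= !sumrN !sumI ?sumI' //; try by move=> x; rewrite !mem_cat => ->;
  rewrite ?orbT.
rewrite !sum0; first lra.
- by move=> t tl; apply: dP'; have : [set` l'] t by []; rewrite el' => -[].
- by move=> t tl; apply: dP; have : [set` l] t by []; rewrite el => -[].
Qed.

End Obstruction.

Ltac psi_decomposition R :=
  have s4 := psi4 R; have [s5 _ _ _] := psi_powers R;
  have : psi R < 2 * psi R ^+ 3 by have [? ? /andP[? ?] /andP[? ?]] := psi_bounds R; lra.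

(** * Subdividing a tile into tiles of the next smaller size *)

Section Decomposition.
Variable R : realType.
Local Notation s := (psi R).
Implicit Types (p q v : R * R) (e : arrow R) (t h : placement R).

Definition long_piece : placement R := Placement (s, 0) (0, s) false true.
Definition short_piece : placement R := Placement (0, 1) (s ^+ 2, 0) true false.
Definition whole_piece : placement R := Placement (0, 0) (1, 0) false true.

(* A large d-tile splits into a large and a small (psi d)-tile, and a small
   d-tile is a large (psi d)-tile. *)
Definition pieces (b : bool) : seq (placement R) :=
  if b then [:: long_piece; short_piece] else [:: whole_piece].

Definition decompose t : seq (placement R) :=
  map (cmp t) (pieces (is_large t)).

(** Since d psi^i = (psi d) psi^(i-1), passing to psi d lowers each color by one. There is no color
    2, so color 3 splits according to psi^2 = psi^4 + psi^6, and both parts run against the old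
    direction. *)
Definition refine_arrow e : seq (arrow R) :=
  if color e == 3%N then
    let m := source e + s ^+ 2 *: direction e in
    [:: (m, source e, 4%N); (target e, m, 6%N)]
  else [:: (source e, target e, (color e).-1)].

Lemma ratio2_pieces b h : h \in pieces b ->
  ratio2 h = if b then (if is_large h then s ^+ 2 else s ^+ 4) else 1.
Proof.
by case: b; rewrite /pieces; each_arrow; rewrite /ratio2 /=; ring.
Qed.

Lemma ratio2_pieces_gt0 b h : h \in pieces b -> 0 < ratio2 h.
Proof.
move=> /ratio2_pieces ->; have := psi_gt0 R.
by case: b => //; case: (is_large h) => ?; rewrite exprn_gt0.
Qed.

Lemma app_long p : app long_piece p = (s - s * p.2, s * p.1).
Proof.
by rewrite /app /lin /flip_sign /= expr0 [LHS]surjective_pairing /=;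
  congr pair; ring.
Qed.

Lemma app_short p : app short_piece p = (s ^+ 2 * p.1, 1 - s ^+ 2 * p.2).
Proof.
by rewrite /app /lin /flip_sign /= expr1 [LHS]surjective_pairing /=;
  congr pair; ring.
Qed.

Lemma app_whole p : app whole_piece p = p.
Proof.
by rewrite /app /lin /flip_sign /= expr0 [LHS]surjective_pairing
  [RHS]surjective_pairing /=; congr pair; ring.
Qed.

Lemma region_long p : region long_piece p <->
  (0 <= p.2 <= s ^+ 2 /\ s - s ^+ 3 <= p.1 <= s) \/
  (0 <= p.2 <= s ^+ 4 /\ 0 <= p.1 <= s).
Proof.
have s0 := psi_gt0 R.
have r0 : 0 < ratio2 long_piece by apply: (@ratio2_pieces_gt0 true); rewrite inE eqxx.
have [q <-] : exists q, app long_piece q = p.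
  by exists (unapp long_piece p); rewrite unappK.
rewrite /region app_image // appK //.
have le a b : (a <= b) = (s * a <= s * b) by rewrite ler_pM2l.
rewrite beeE app_long /= !(le _ q.1) !(le q.1) !(le _ q.2) !(le q.2) mulr0 mulr1.
split; case=> -[h1 h2]; [left|right|left|right]; lra.
Qed.

Lemma inner_long p : inner long_piece p <->
  (0 < p.2 < s ^+ 2 /\ s - s ^+ 3 < p.1 < s) \/
  (0 < p.2 < s ^+ 4 /\ 0 < p.1 < s).
Proof.
have s0 := psi_gt0 R.
have r0 : 0 < ratio2 long_piece by apply: (@ratio2_pieces_gt0 true); rewrite inE eqxx.
have [q <-] : exists q, app long_piece q = p.
  by exists (unapp long_piece p); rewrite unappK.
rewrite /inner app_image // appK //.
have lt a b : (a < b) = (s * a < s * b) by rewrite ltr_pM2l.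
rewrite open_beeE app_long /= !(lt _ q.1) !(lt q.1) !(lt _ q.2) !(lt q.2) mulr0 mulr1.
split; case=> -[h1 h2]; [left|right|left|right]; lra.
Qed.

Lemma region_short p : region short_piece p <->
  (0 <= p.1 <= s ^+ 3 /\ 1 - s ^+ 4 <= p.2 <= 1) \/
  (0 <= p.1 <= s ^+ 5 /\ 1 - s ^+ 2 <= p.2 <= 1).
Proof.
have s0 : 0 < s ^+ 2 by rewrite exprn_gt0 ?psi_gt0.
have r0 : 0 < ratio2 short_piece.
  by apply: (@ratio2_pieces_gt0 true); rewrite !inE eqxx orbT.
have [q <-] : exists q, app short_piece q = p.
  by exists (unapp short_piece p); rewrite unappK.
rewrite /region app_image // appK //.
have le a b : (a <= b) = (s ^+ 2 * a <= s ^+ 2 * b) by rewrite ler_pM2l.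
rewrite beeE app_short /= !(le _ q.1) !(le q.1) !(le _ q.2) !(le q.2) mulr0 mulr1.
split; case=> -[h1 h2]; [left|right|left|right]; lra.
Qed.

Lemma inner_short p : inner short_piece p <->
  (0 < p.1 < s ^+ 3 /\ 1 - s ^+ 4 < p.2 < 1) \/
  (0 < p.1 < s ^+ 5 /\ 1 - s ^+ 2 < p.2 < 1).
Proof.
have s0 : 0 < s ^+ 2 by rewrite exprn_gt0 ?psi_gt0.
have r0 : 0 < ratio2 short_piece.
  by apply: (@ratio2_pieces_gt0 true); rewrite !inE eqxx orbT.
have [q <-] : exists q, app short_piece q = p.
  by exists (unapp short_piece p); rewrite unappK.
rewrite /inner app_image // appK //.
have lt a b : (a < b) = (s ^+ 2 * a < s ^+ 2 * b) by rewrite ltr_pM2l.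
rewrite open_beeE app_short /= !(lt _ q.1) !(lt q.1) !(lt _ q.2) !(lt q.2) mulr0 mulr1.
split; case=> -[h1 h2]; [left|right|left|right]; lra.
Qed.

Lemma region_whole : region whole_piece = bee R.
Proof.
rewrite /region (_ : app whole_piece = id) ?image_id //.
by apply/funext=> p; exact: app_whole.
Qed.

Lemma inner_whole : inner whole_piece = open_bee R.
Proof.
rewrite /inner (_ : app whole_piece = id) ?image_id //.
by apply/funext=> p; exact: app_whole.
Qed.

Lemma bee_pieces b p : bee R p <-> exists2 h, h \in pieces b & region h p.
Proof.
case: b => /=; last first.
  split=> [bp|[h]]; first by exists whole_piece; rewrite ?inE // region_whole.
  by rewrite inE => /eqP ->; rewrite region_whole.
psi_decomposition R => ?; psi_order R.
split=> [/beeE bp|[h]]; last first.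
  by rewrite !inE => /orP[] /eqP -> => [/region_long|/region_short] hp; apply/beeE;
    case: hp => hp; lra.
have [hl|nhl] := pselect (region long_piece p); first by exists long_piece; rewrite ?inE ?eqxx.
exists short_piece; first by rewrite !inE eqxx orbT.
by apply/region_short; move: nhl; rewrite region_long; case: bp => bp; lra.
Qed.

Lemma inner_pieces b h : h \in pieces b -> inner h `<=` open_bee R.
Proof.
move=> hb p; psi_decomposition R => ?; psi_order R.
case: b hb; rewrite /pieces; each_arrow.
- by move=> /inner_long hp; apply/open_beeE; case: hp => hp; lra.
- by move=> /inner_short hp; apply/open_beeE; case: hp => hp; lra.
- by rewrite inner_whole.
Qed.

Lemma apart_pieces b h h' : h \in pieces b -> h' \in pieces b -> h <> h' ->
  apart h h'.
Proof.
psi_decomposition R => ?; psi_order R.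
have ls : apart long_piece short_piece.
  by move=> p /inner_long hp /inner_short hp'; case: hp => hp; case: hp' => hp'; lra.
case: b; rewrite /pieces !in_cons !in_nil !orbF; last by move=> /eqP -> /eqP ->.
by move=> /orP[] /eqP -> /orP[] /eqP -> neq;
  [case: neq | exact: ls | move=> p h1 h2; exact: ls h2 h1 | case: neq].
Qed.

End Decomposition.

(** * The arrows of the pieces *)

Section RefinedArrows.
Variable R : realType.
Local Notation s := (psi R).
Implicit Types (p q v : R * R) (e : arrow R) (t h : placement R).

Lemma arrows_long : arrows (long_piece R) =
  [:: ((s, 0), (s ^+ 3, 0), 4%N);
    ((- s + 2 * s ^+ 3, 0), (s ^+ 3, 0), 4%N);
    ((0, 0), (- s + 2 * s ^+ 3, 0), 6%N);
    ((s, s ^+ 2), (s, 1 - s ^+ 2), 5%N);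
    ((s, 1 - s ^+ 2), (s, 0), 3%N);
    ((s - s ^+ 3, s ^+ 2), (s ^+ 3, s ^+ 2), 6%N);
    ((s ^+ 3, s ^+ 2), (s, s ^+ 2), 4%N);
    ((s - s ^+ 3, 1 - s ^+ 2), (s - s ^+ 3, s ^+ 2), 5%N);
    ((0, 1 - s ^+ 2), (s - s ^+ 3, 1 - s ^+ 2), 4%N);
    ((0, 0), (0, 1 - s ^+ 2), 3%N)].
Proof.
rewrite /arrows /= /map_arrow /source /target /color /= !app_long /=.
have hs := psi4 R; do ?[congr cons]; do ?[congr pair]; ring: hs.
Qed.

Lemma arrows_short : arrows (short_piece R) =
  [:: ((0, 1), (0, 2 - 2 * s ^+ 2), 5%N);
    ((0, 2 - 2 * s ^+ 2), (0, 1 - s ^+ 2), 3%N);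
    ((s ^+ 3, 1), (s - s ^+ 3, 1), 6%N);
    ((s - s ^+ 3, 1), (0, 1), 4%N);
    ((s ^+ 3, 1), (s ^+ 3, s ^+ 2), 3%N);
    ((s - s ^+ 3, s ^+ 2), (s ^+ 3, s ^+ 2), 6%N);
    ((s - s ^+ 3, 1 - s ^+ 2), (s - s ^+ 3, s ^+ 2), 5%N);
    ((0, 1 - s ^+ 2), (s - s ^+ 3, 1 - s ^+ 2), 4%N)].
Proof.
rewrite /arrows /= /map_arrow /source /target /color /= !app_short /=.
have hs := psi4 R; do ?[congr cons]; do ?[congr pair]; ring: hs.
Qed.

Lemma arrows_whole : arrows (whole_piece R) = large_arrows R.
Proof.
rewrite /arrows (@eq_map _ _ _ id) ?map_id // => -[[p q] i].
by rewrite /map_arrow !app_whole.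
Qed.

(** The arrows common to [arrows_long] and [arrows_short]. They are new: none of them is a part of
    an arrow of the large tile. *)
Definition border_arrows : seq (arrow R) :=
  [:: ((s - s ^+ 3, s ^+ 2), (s ^+ 3, s ^+ 2), 6%N);
    ((s - s ^+ 3, 1 - s ^+ 2), (s - s ^+ 3, s ^+ 2), 5%N);
    ((0, 1 - s ^+ 2), (s - s ^+ 3, 1 - s ^+ 2), 4%N)].

Lemma refine_large : flatten (map (@refine_arrow R) (large_arrows R)) =
  [:: ((0, 0), (0, 1 - s ^+ 2), 3%N);
    ((0, 2 - 2 * s ^+ 2), (0, 1 - s ^+ 2), 3%N);
    ((0, 1), (0, 2 - 2 * s ^+ 2), 5%N);
    ((s, 0), (s ^+ 3, 0), 4%N);
    ((- s + 2 * s ^+ 3, 0), (s ^+ 3, 0), 4%N);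
    ((0, 0), (- s + 2 * s ^+ 3, 0), 6%N);
    ((s, s ^+ 2), (s, 1 - s ^+ 2), 5%N);
    ((s, 1 - s ^+ 2), (s, 0), 3%N);
    ((s ^+ 3, s ^+ 2), (s, s ^+ 2), 4%N);
    ((s ^+ 3, 1), (s ^+ 3, s ^+ 2), 3%N);
    ((s - s ^+ 3, 1), (0, 1), 4%N);
    ((s ^+ 3, 1), (s - s ^+ 3, 1), 6%N)].
Proof.
rewrite /= /refine_arrow /source /target /color /direction /=.
have hs := psi4 R; do ?[congr cons]; do ?[congr pair]; rewrite /= /GRing.scale /=; ring: hs.
Qed.

Lemma refine_small :
  flatten (map (@refine_arrow R) (small_arrows R)) =i large_arrows R.
Proof.
have -> : flatten (map (@refine_arrow R) (small_arrows R)) =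
    [seq nth ((0, 0), (0, 0), 0%N) (large_arrows R) i
       | i <- [:: 0; 1; 2; 3; 4; 6; 5; 7; 8; 9]%N].
  rewrite /= /refine_arrow /source /target /color /direction /=.
  have hs := psi4 R; do ?[congr cons]; do ?[congr pair]; rewrite /= /GRing.scale /=; ring: hs.
by move=> e; rewrite /= !in_cons; do 5 congr orb; rewrite orbCA.
Qed.

(** Reduces the inclusion of explicit lists to a list of positions, so that computation checks it
    and no membership test in the reals is needed. *)
Lemma subset_nth (T : eqType) (x0 : T) (l : seq T) (idx : seq nat) :
  all (fun i => i < size l)%N idx ->
  {subset [seq nth x0 l i | i <- idx] <= l}.
Proof. by move=> /allP h x /mapP[i /h hi ->]; exact: mem_nth. Qed.

Let x0 : arrow R := ((0, 0), (0, 0), 0%N).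

Lemma piece_arrow b h e : h \in pieces R b -> e \in arrows h ->
  e \in flatten (map (@refine_arrow R) (base_arrows R b)) \/
  b /\ e \in border_arrows.
Proof.
case: b; rewrite [base_arrows R _]/= /pieces; last first.
  by rewrite inE => /eqP ->; rewrite arrows_whole refine_small; left.
rewrite refine_large !in_cons in_nil orbF => /orP[] /eqP -> he;
  suff /orP[|] : (e \in flatten (map (@refine_arrow R) (large_arrows R)))
    || (e \in border_arrows); rewrite ?refine_large; try by [left | right];
  rewrite -mem_cat; move: e he.
  rewrite arrows_long; set l := _ ++ _.
  (* Positions 0 to 11 are parts of the arrows of the large tile, 12 to 14 are the border arrows. *)
  exact: (@subset_nth _ x0 l [:: 3; 4; 5; 6; 7; 12; 8; 13; 14; 0]%N).
rewrite arrows_short; set l := _ ++ _.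
exact: (@subset_nth _ x0 l [:: 2; 1; 11; 10; 9; 12; 13; 14]%N).
Qed.

Lemma refined_arrow_piece b e :
  e \in flatten (map (@refine_arrow R) (base_arrows R b)) ->
  exists2 h, h \in pieces R b & e \in arrows h.
Proof.
case: b; rewrite [base_arrows R _]/= /pieces; last first.
  by rewrite refine_small => he; exists (whole_piece R); rewrite ?mem_head ?arrows_whole.
move=> he; suff : e \in arrows (long_piece R) ++ arrows (short_piece R).
  by rewrite mem_cat => /orP[] ?; [exists (long_piece R) | exists (short_piece R)];
    rewrite // !in_cons eqxx ?orbT.
move: e he; rewrite refine_large arrows_long arrows_short; set l := _ ++ _.
(* Positions 0 to 9 belong to the long piece, 10 to 17 to the short one. *)
exact: (@subset_nth _ x0 l [:: 9; 11; 10; 0; 1; 2; 3; 4; 6; 14; 13; 12]%N).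
Qed.

(** The border path runs through the interior of the large tile but starts and ends on its boundary.
    Midpoints of distinct points avoid these two ends. *)
Lemma border_arrow e p q : e \in border_arrows -> p <> q ->
  segment e p -> segment e q -> open_bee R (p + (1 / 2) *: (q - p)).
Proof.
move=> he pq; psi_decomposition R => ?; psi_order R.
move: he; rewrite /border_arrows; each_arrow;
  rewrite ?segment_vert ?segment_horiz => hp hq; rewrite open_beeE;
  case: p q pq hp hq => p1 p2 [q1 q2] /= pq [? hp] [? hq]; subst;
  rewrite /= /GRing.scale /=; right.
- have : p1 != q1 by apply/eqP => e1; apply: pq; rewrite e1.
  by rewrite neq_lt => /orP[] ?; case: hp => hp; case: hq => hq; lra.
- by case: hp => hp; case: hq => hq; lra.
- have : p1 != q1 by apply/eqP => e1; apply: pq; rewrite e1.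
  by rewrite neq_lt => /orP[] ?; case: hp => hp; case: hq => hq; lra.
Qed.

End RefinedArrows.

Section RefinementOfTilings.
Variable R : realType.
Local Notation s := (psi R).
Implicit Types (p q v : R * R) (e : arrow R) (t h c : placement R).

Lemma refine_map t e : refine_arrow (map_arrow (app t) e) =
  map (map_arrow (app t)) (refine_arrow e).
Proof.
rewrite /refine_arrow direction_map; case: e => [[p q] i] /=.
by case: ifP => //= _; rewrite /map_arrow /source /target /= app_conv.
Qed.

Lemma refine_sub e e' : e' \in refine_arrow e -> segment e' `<=` segment e.
Proof.
have k : 0 <= s ^+ 2 <= 1 by psi_order R; lra.
have sm : segment e (source e + s ^+ 2 *: direction e).
  by apply/segmentP; exists (s ^+ 2).
have sub f : segment e (source f) -> segment e (target f) ->
    segment f `<=` segment e.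
  by move=> h1 h2 p /segmentP[a ha ->]; exact: segment_conv.
by rewrite /refine_arrow; case: ifP => _; rewrite ?in_cons in_nil ?orbF;
  [case/orP|] => /eqP ->; apply: sub => //;
  (exact: segment_source || exact: segment_target).
Qed.

Lemma refine_overlap e e1 e2 : e1 \in refine_arrow e -> e2 \in refine_arrow e ->
  overlap e1 e2 -> e1 = e2.
Proof.
have no : ~ overlap (source e + s ^+ 2 *: direction e, source e, 4%N)
                    (target e, source e + s ^+ 2 *: direction e, 6%N).
  have [k0 k1] : 0 < s ^+ 2 /\ s ^+ 2 < 1 by psi_order R; lra.
  have key r : segment (source e + s ^+ 2 *: direction e, source e, 4%N) r ->
      segment (target e, source e + s ^+ 2 *: direction e, 6%N) r ->
      r = source e + s ^+ 2 *: direction e.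
    case: e => [[[P1 P2] [Q1 Q2]] i]; case: r => r1 r2.
    move=> /segmentP[a /andP[a0 a1]] ra /segmentP[b /andP[b0 b1]] rb.
    have := congr1 fst ra; have := congr1 snd ra.
    have := congr1 fst rb; have := congr1 snd rb.
    rewrite /direction /source /target /= /GRing.scale /=.
    move: (s ^+ 2) k0 k1 => k k0 k1 b2 b1' a2 a1'.
    have k' : 0 < 1 - k by rewrite subr_gt0.
    have ka : 0 <= k * a by rewrite mulr_ge0 // ltW.
    have kb : 0 <= (1 - k) * (1 - b) by rewrite mulr_ge0 ?subr_ge0 // ltW.
    (* The distance, in units of the whole arrow, between the positions that the two parts assign to
       [r]. Either it is 0 and [r] is the dividing point, or the arrow is degenerate and all points
       coincide. *)
    pose c := k * a + (1 - k) * (1 - b).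
    have c1 : c * (Q1 - P1) = 0.
      by transitivity (r1 - r1); [rewrite {1}b1' a1' /c; ring | rewrite subrr].
    have c2 : c * (Q2 - P2) = 0.
      by transitivity (r2 - r2); [rewrite {1}b2 a2 /c; ring | rewrite subrr].
    rewrite [RHS]surjective_pairing /= /GRing.scale /=.
    have [c0|c0] := eqVneq c 0.
      have /eqP : k * a = 0 by move: c0; rewrite /c; lra.
      rewrite mulf_eq0 (gt_eqF k0) /= => /eqP az.
      by congr pair; [rewrite a1' az | rewrite a2 az]; ring.
    move/eqP: c1; rewrite mulf_eq0 (negbTE c0) /= subr_eq0 => /eqP q1.
    move/eqP: c2; rewrite mulf_eq0 (negbTE c0) /= subr_eq0 => /eqP q2.
    by congr pair; [rewrite a1' q1 | rewrite a2 q2]; ring.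
  by move=> [p [q [pq [p1 p2] [q1 q2]]]]; apply: pq; rewrite (key _ p1 p2) (key _ q1 q2).
rewrite /refine_arrow; case: ifP => _; last first.
  by rewrite !in_cons !in_nil !orbF => /eqP -> /eqP ->.
rewrite /= !in_cons !in_nil !orbF.
have [-> _|_ /= /eqP ->] := eqVneq e1 (source e + s ^+ 2 *: direction e, source e, 4%N).
  have [-> //|_ /= /eqP ->] := eqVneq e2 (source e + s ^+ 2 *: direction e, source e, 4%N).
  by move=> o; case: (no o).
have [-> _|_ /= /eqP -> //] := eqVneq e2 (source e + s ^+ 2 *: direction e, source e, 4%N).
by move=> /overlap_sym o; case: (no o).
Qed.

End RefinementOfTilings.

Section Subdivision.
Variable R : realType.
Local Notation s := (psi R).
Implicit Types (p q v : R * R) (e : arrow R) (t h c g : placement R).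
Implicit Types P : set (placement R).

Lemma pair_neq p q : p <> q -> p.1 = q.1 -> p.2 < q.2 \/ q.2 < p.2.
Proof.
case: p q => p1 p2 [q1 q2] /= pq e1; apply/orP; rewrite -neq_lt; apply/eqP => e2.
by apply: pq; rewrite e1 e2.
Qed.

Lemma pair_neq' p q : p <> q -> p.2 = q.2 -> p.1 < q.1 \/ q.1 < p.1.
Proof.
case: p q => p1 p2 [q1 q2] /= pq e1; apply/orP; rewrite -neq_lt; apply/eqP => e2.
by apply: pq; rewrite e1 e2.
Qed.

(* The common boundary of the two pieces of a large tile. *)
Definition seam p : Prop :=
  (p.2 = 1 - s ^+ 2 /\ 0 <= p.1 <= s - s ^+ 3) \/
  (p.1 = s - s ^+ 3 /\ 1 - s ^+ 2 <= p.2 <= s ^+ 2) \/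
  (p.2 = s ^+ 2 /\ s - s ^+ 3 <= p.1 <= s ^+ 3).

Lemma region_seam p : region (long_piece R) p -> region (short_piece R) p -> seam p.
Proof.
move=> /region_long h1 /region_short h2; psi_decomposition R => ?; psi_order R.
by case: h1 => h1; case: h2 => h2; rewrite /seam; lra.
Qed.

(** Two distinct points of the seam on a vertical line force the abscissa s - s^3. On a horizontal
    line they force one of the heights 1 - s^2 and s^2. This rejects the arrows on all other
    lines. *)
Lemma seam_arrow h e p q : h \in pieces R true -> e \in arrows h ->
  p <> q -> segment e p -> segment e q -> seam p -> seam q ->
  e \in border_arrows R.
Proof.
move=> hh he pq hp hq sp sq.
have vert : p.1 = q.1 -> p.1 = s - s ^+ 3.
  move=> e1; case: (pair_neq pq e1); move: sp sq; rewrite /seam; psi_order R; lra.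
have horiz : p.2 = q.2 -> (p.2 = 1 - s ^+ 2 /\ p.1 <= s - s ^+ 3 /\ q.1 <= s - s ^+ 3)
    \/ (p.2 = s ^+ 2 /\ p.1 <= s ^+ 3 /\ q.1 <= s ^+ 3 /\ s - s ^+ 3 <= p.1 /\ s - s ^+ 3 <= q.1).
  move=> e2; case: (pair_neq' pq e2); move: sp sq; rewrite /seam; psi_order R; lra.
psi_decomposition R => ?; psi_order R.
pose x0 : arrow R := ((0, 0), (0, 0), 0%N).
have bor i : (i < 3)%N -> nth x0 (border_arrows R) i \in border_arrows R.
  by move=> hi; apply: mem_nth.
have neq := pair_neq' pq.
have nv (c : R) : c <> s - s ^+ 3 -> p.1 = c -> q.1 = c -> False.
  by move=> hc e1 e2; apply: hc; rewrite -e1; apply: vert; rewrite e1 e2.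
have nh (c : R) : c < 1 - s ^+ 2 \/ s ^+ 2 < c -> p.2 = c -> q.2 = c -> False.
  by move=> hc e1 e2; have := horiz (etrans e1 (esym e2)); lra.
move: hh hp hq; rewrite /pieces !in_cons in_nil orbF => /orP[] /eqP eh; subst h;
  move: he; rewrite ?arrows_long ?arrows_short; each_arrow;
  rewrite ?segment_vert ?segment_horiz => -[e1 h1] [e2 h2].
- by case: (nh _ _ e1 e2); clear - R; psi_order R; lra.
- by case: (nh _ _ e1 e2); clear - R; psi_order R; lra.
- by case: (nh _ _ e1 e2); clear - R; psi_order R; lra.
- by case: (nv _ _ e1 e2); clear - R; psi_decomposition R => ?; psi_order R; lra.
- by case: (nv _ _ e1 e2); clear - R; psi_decomposition R => ?; psi_order R; lra.
- exact: (bor 0%N isT).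
(* The arrow from (s^3, s^2) to (s, s^2) continues the line of the seam but meets the seam only in
   its source. *)
- exfalso; move: (horiz (etrans e1 (esym e2))) (neq (etrans e1 (esym e2))) h1 h2.
  by rewrite e1; clear - R; psi_order R; case=> [[? [? ?]]|[? ?]] [?|?] [?|?] [?|?]; lra.
- exact: (bor 1%N isT).
- exact: (bor 2%N isT).
- by case: (nv _ _ e1 e2); clear - R; psi_decomposition R => ?; psi_order R; lra.
- by case: (nv _ _ e1 e2); clear - R; psi_decomposition R => ?; psi_order R; lra.
- by case: (nv _ _ e1 e2); clear - R; psi_decomposition R => ?; psi_order R; lra.
- by case: (nh _ _ e1 e2); clear - R; psi_order R; lra.
- by case: (nh _ _ e1 e2); clear - R; psi_order R; lra.
- by case: (nv _ _ e1 e2); clear - R; psi_decomposition R => ?; psi_order R; lra.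
- exact: (bor 0%N isT).
- exact: (bor 1%N isT).
- exact: (bor 2%N isT).
Qed.

Lemma border_overlap e e' : e \in border_arrows R -> e' \in border_arrows R ->
  overlap e e' -> e = e'.
Proof.
move=> he he' [p [q [pq [pe pe'] [qe qe']]]].
psi_order R; move: he he' pe pe' qe qe'; rewrite /border_arrows; each_arrow; each_arrow => //;
  rewrite ?segment_vert ?segment_horiz => -[? _] [? _] [? _] [? _];
  exfalso; apply: pq; rewrite [p]surjective_pairing [q]surjective_pairing;
  congr pair; lra.
Qed.

Lemma pieces_compatible b h h' : h \in pieces R b -> h' \in pieces R b ->
  h <> h' -> compatible h h'.
Proof.
have ls : compatible (long_piece R) (short_piece R).
  have [hl hs] : long_piece R \in pieces R true /\ short_piece R \in pieces R true.
    by rewrite !in_cons !eqxx orbT.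
  have [l0 s0] := (ratio2_pieces_gt0 hl, ratio2_pieces_gt0 hs).
  move=> e e' he he' o; have [p [q [pq [pe pe'] [qe qe']]]] := o.
  have sp : seam p.
    exact: region_seam (arrow_in_region l0 he pe).1 (arrow_in_region s0 he' pe').1.
  have sq : seam q.
    exact: region_seam (arrow_in_region l0 he qe).1 (arrow_in_region s0 he' qe').1.
  apply: border_overlap o.
    exact: seam_arrow hl he pq pe qe sp sq.
  exact: seam_arrow hs he' pq pe' qe' sp sq.
case: b; rewrite /pieces !in_cons !in_nil !orbF; last by move=> /eqP -> /eqP ->.
by move=> /orP[] /eqP -> /orP[] /eqP -> neq;
  [case: neq | exact: ls | move=> e e' he he' /overlap_sym o; apply/esym/ls
  | case: neq].
Qed.

End Subdivision.

Section LegalPatches.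
Variable R : realType.
Local Notation s := (psi R).
Implicit Types (p q v : R * R) (e : arrow R) (t h c g : placement R).
Implicit Types P : set (placement R).

Lemma decompose_region t p :
  region t p <-> exists2 c, c \in decompose t & region c p.
Proof.
split=> [[q /(bee_pieces (is_large t)) [h hh hq] <-]|[_ /mapP[h hh ->]]].
  by exists (cmp t h); [exact: map_f | rewrite region_cmp; exists q].
rewrite region_cmp => -[q hq <-]; exists q => //.
by apply/(bee_pieces (is_large t)); exists h.
Qed.

Lemma decompose_inner t c : c \in decompose t -> inner c `<=` inner t.
Proof.
move=> /mapP[h hh ->]; rewrite inner_cmp => p [q hq <-]; exists q => //.
exact: inner_pieces hh _ hq.
Qed.

Lemma decompose_ratio2 t c : 0 < ratio2 t -> c \in decompose t -> 0 < ratio2 c.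
Proof.
by move=> t0 /mapP[h hh ->]; rewrite ratio2_cmp mulr_gt0 // (ratio2_pieces_gt0 hh).
Qed.

Lemma decompose_d_placement d t c : d_placement d t -> c \in decompose t ->
  d_placement (s * d) c.
Proof.
rewrite /d_placement => dt /mapP[h hh ->]; rewrite ratio2_cmp dt.
rewrite (ratio2_pieces hh) /=; case: (is_large t) hh => hh; last first.
  by move: hh; rewrite /pieces inE => /eqP -> /=; ring.
by case: (is_large h); ring.
Qed.

(** The dichotomy behind all statements on subdivided patches: an arrow of a piece is inherited from
    the parent, or it runs inside the parent and concerns no other tile. *)
Lemma decompose_arrow t c e : 0 < ratio2 t -> c \in decompose t ->
  e \in arrows c -> (exists2 e0, e0 \in arrows t & e \in refine_arrow e0) \/
  (forall p q, p <> q -> segment e p -> segment e q ->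
     inner t (p + (1 / 2) *: (q - p))).
Proof.
move=> t0 /mapP[h hh ->]; rewrite arrows_cmp => /mapP[f hf ->].
have [/flatten_mapP[e0 he0 hf0]|[_ hb]] := piece_arrow hh hf.
  left; exists (map_arrow (app t) e0); first exact: map_f.
  by rewrite refine_map map_f.
right=> p q pq; rewrite segment_map => -[p' hp ep] [q' hq eq]; subst p q.
exists (p' + (1 / 2) *: (q' - p')); last by rewrite app_conv -app_sub.
by apply: border_arrow hb _ hp hq => e'; apply: pq; rewrite e'.
Qed.

Lemma decompose_refined t e0 e : e0 \in arrows t -> e \in refine_arrow e0 ->
  exists2 c, c \in decompose t & e \in arrows c.
Proof.
move=> /mapP[f hf ->]; rewrite refine_map => /mapP[f' hf' ->].
have [|h hh fh] := @refined_arrow_piece _ (is_large t) f'.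
  by apply/flatten_mapP; exists f.
exists (cmp t h); first exact: map_f.
by rewrite arrows_cmp map_f.
Qed.

Definition legal P : Prop :=
  (forall t, P t -> 0 < ratio2 t) /\
  (forall t t', P t -> P t' -> t <> t' -> apart t t' /\ compatible t t').

Definition subdivide P : set (placement R) :=
  [set c | exists2 t, P t & c \in decompose t].

Lemma compatible_map g t t' : 0 < ratio2 g -> compatible t t' ->
  compatible (cmp g t) (cmp g t').
Proof.
move=> g0 ct e e'; rewrite !arrows_cmp => /mapP[f hf ->] /mapP[f' hf' ->].
by move=> /(overlap_map f f' g0) /(ct _ _ hf hf') ->.
Qed.

Lemma apart_map g t t' : 0 < ratio2 g -> apart t t' -> apart (cmp g t) (cmp g t').
Proof.
move=> g0 a p; rewrite !inner_cmp => -[q hq <-] [q' hq' /(app_inj g0) eq].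
by apply: (a q) => //; rewrite -eq.
Qed.

Lemma legal_move g P : 0 < ratio2 g -> legal P -> legal (cmp g @` P).
Proof.
move=> g0 [P0 hP]; split=> [_ [t Pt <-]|_ _ [t Pt <-] [t' Pt' <-] neq].
  by rewrite ratio2_cmp mulr_gt0 // P0.
have [|a c] := hP t t' Pt Pt'; first by move=> e; apply: neq; rewrite e.
by split; [exact: apart_map | exact: compatible_map].
Qed.

(** Suppose that arrows of pieces of different tiles overlap. Neither can be new, as midpoints of
    the overlap would be interior to one parent and lie in the other. So both are parts of parent
    arrows, which overlap and hence coincide, and different parts of one arrow do not overlap. *)
Lemma legal_subdivide P : legal P -> legal (subdivide P).
Proof.
move=> [P0 hP]; split=> [c [t Pt]|]; first exact/decompose_ratio2/P0.
have half p q : p <> q -> forall e, segment e p -> segment e q ->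
    segment e (p + (1 / 2) *: (q - p)).
  by move=> _ e; apply: segment_conv; lra.
move=> c c' [t Pt ct] [t' Pt' ct'] neq.
have [tt'|tt'] := pselect (t = t').
  subst t'; move: ct ct' => /mapP[h hh ec] /mapP[h' hh' ec'].
  have hh'n : h <> h' by move=> eh; apply: neq; rewrite ec ec' eh.
  rewrite ec ec'; split.
    exact: apart_map (P0 _ Pt) (apart_pieces hh hh' hh'n).
  exact: compatible_map (P0 _ Pt) (pieces_compatible hh hh' hh'n).
have [a k] := hP _ _ Pt Pt' tt'; split.
  by move=> p /(decompose_inner ct) ip /(decompose_inner ct') /(a _ ip).
have a' : apart t' t by move=> p ip' ip; exact: a ip ip'.
have reg u c1 e p : P u -> c1 \in decompose u -> e \in arrows c1 ->
    segment e p -> region u p.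
  move=> Pu cu ec ep; apply/decompose_region; exists c1 => //.
  exact: (arrow_in_region (decompose_ratio2 (P0 _ Pu) cu) ec ep).1.
move=> e e' ec ec' o; have [p [q [pq [pe pe'] [qe qe']]]] := o.
have [[e0 he0 re]|he] := decompose_arrow (P0 _ Pt) ct ec; last first.
  have := he p q pq pe qe => im.
  case: (apart_region (P0 _ Pt) a' _ im).
  exact: reg Pt' ct' ec' (half _ _ pq _ pe' qe').
have [[e0' he0' re']|he'] := decompose_arrow (P0 _ Pt') ct' ec'; last first.
  have := he' p q pq pe' qe' => im.
  case: (apart_region (P0 _ Pt') a _ im).
  exact: reg Pt ct ec (half _ _ pq _ pe qe).
have e00 : e0 = e0'.
  by apply: k => //; apply: overlap_sub o; exact: refine_sub.
by subst e0'; exact: refine_overlap re re' o.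
Qed.

End LegalPatches.

(** * The tiling of the upper half plane *)

Section UpperHalfPlane.
Variable R : realType.
Local Notation s := (psi R).
Implicit Types (p q v : R * R) (e f : arrow R) (t h c g : placement R).
Implicit Types P : set (placement R).

(* 1 + psi^2 = psi^-2, so that growing compensates for two subdivisions. *)
Definition grow : placement R := Placement (0, 0) (- (1 + s ^+ 2), 0) true true.

(** Its longest side lies on the axis, from psi^2 - 1 to psi^2. The position is such that the
    contraction inverse to [grow], which reflects in the vertical axis, carries the tile to the
    small piece that appears after two subdivisions. *)
Definition seed : placement R := Placement (s ^+ 2, 0) (0, 1) false false.

Definition next P : set (placement R) := cmp grow @` subdivide (subdivide P).

Fixpoint patch n : set (placement R) :=
  if n is m.+1 then next (patch m) else [set seed].

Definition upper : set (placement R) := [set t | exists n, patch n t].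

Lemma app_grow p : app grow p = (- (1 + s ^+ 2) * p.1, (1 + s ^+ 2) * p.2).
Proof.
by rewrite /app /lin /flip_sign /= expr1 [LHS]surjective_pairing /=;
  congr pair; ring.
Qed.

Lemma app_seed p : app seed p = (s ^+ 2 - p.2, p.1).
Proof.
by rewrite /app /lin /flip_sign /= expr0 [LHS]surjective_pairing /=;
  congr pair; ring.
Qed.

Lemma ratio2_grow : ratio2 grow = (1 + s ^+ 2) ^+ 2.
Proof. by rewrite /ratio2 /=; ring. Qed.

Lemma ratio2_grow_gt0 : 0 < ratio2 grow.
Proof. by rewrite ratio2_grow exprn_gt0 //; psi_order R; lra. Qed.

Lemma ratio2_seed : ratio2 seed = 1.
Proof. by rewrite /ratio2 /=; ring. Qed.

Lemma patch_seed : patch 1 seed.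
Proof.
pose c := cmp seed (whole_piece R).
exists (cmp c (short_piece R)).
  exists c; last by apply: map_f; rewrite /pieces !in_cons eqxx orbT.
  by exists seed => //; apply: map_f; rewrite /pieces mem_head.
have s4 := psi4 R.
rewrite /cmp /seed /= !app_cmp app_grow app_seed app_whole !lin_cmp /=.
congr (Placement _ _ _ _); rewrite /lin /flip_sign /= ?expr0 ?expr1;
  congr pair; ring: s4.
Qed.

Lemma subdivide_sub P P' : P `<=` P' -> subdivide P `<=` subdivide P'.
Proof. by move=> h c [t /h Pt ct]; exists t. Qed.

Lemma patch_sub n : patch n `<=` patch n.+1.
Proof.
elim: n => [|n IH]; first by move=> t ->; exact: patch_seed.
exact/image_subset/subdivide_sub/subdivide_sub.
Qed.

Lemma patch_le m n : (m <= n)%N -> patch m `<=` patch n.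
Proof.
elim: n => [|n IH]; first by rewrite leqn0 => /eqP ->.
rewrite leq_eqVlt => /orP[/eqP -> //|/IH h] t /h; exact: patch_sub.
Qed.

Lemma legal_patch n : legal (patch n).
Proof.
elim: n => [|n IH]; last first.
  by apply: legal_move ratio2_grow_gt0 _; do 2!apply: legal_subdivide.
by split=> [t ->|t t' -> ->]; [rewrite ratio2_seed|].
Qed.

Lemma legal_upper : legal upper.
Proof.
split=> [t [n /(legal_patch n).1//]|t t' [m Pt] [n Pt']].
by apply: (legal_patch (maxn m n)).2; [apply: patch_le Pt; exact: leq_maxl
  | apply: patch_le Pt'; exact: leq_maxr].
Qed.

(** The seed is a small tile of ratio 1, whence the value psi^-1. Two subdivisions multiply it by
    psi^2, and the growth undoes this. *)
Lemma patch_d_placement n t : patch n t -> d_placement s^-1 t.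
Proof.
have s0 := psi_gt0 R; have s1 : s != 0 by rewrite gt_eqF.
elim: n t => [t ->|n IH _ [c [c1 [t /IH dt tc] cc] <-]].
  by rewrite /d_placement ratio2_seed /= exprVn divff // expf_neq0.
have := decompose_d_placement (decompose_d_placement dt tc) cc.
rewrite /d_placement ratio2_cmp ratio2_grow /= => ->.
rewrite mulrCA -exprMn; congr (_ * _); congr (_ ^+ 2).
have s4 := psi4 R; apply: (mulIf s1).
by rewrite -!mulrA mulVf // !mulr1; ring: s4.
Qed.

Lemma decompose_sub t c p : c \in decompose t -> region c p -> region t p.
Proof. by move=> ct cp; apply/decompose_region; exists c. Qed.

Lemma patch_upper n t p : patch n t -> (region t p -> 0 <= p.2) /\
  (inner t p -> 0 < p.2).
Proof.
have k0 : 0 < 1 + s ^+ 2 by psi_order R; lra.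
elim: n t p => [t p ->|n IH _ p [c [c1 [t Pt tc] cc] <-]].
  split=> [[q /beeE bq]|[q /open_beeE bq]]; rewrite app_seed => <- /=; case: bq; lra.
rewrite region_cmp inner_cmp; split=> -[q hq <-]; rewrite app_grow /=.
  rewrite pmulr_rge0 //; apply: (IH t q Pt).1.
  exact: decompose_sub tc (decompose_sub cc hq).
rewrite pmulr_rgt0 //; apply: (IH t q Pt).2.
exact: (decompose_inner tc (decompose_inner cc hq)).
Qed.

(** The seed contains the rectangle with abscissas in [-1/3, 1/3] and heights in [0, 1/3];
    subdivision keeps the covered set and the growth enlarges it. *)
Lemma patch_cover n p : `|p.1| <= (1 + s ^+ 2) ^+ n / 3 ->
  0 <= p.2 <= (1 + s ^+ 2) ^+ n / 3 -> exists2 t, patch n t & region t p.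
Proof.
have k0 : 0 < s ^+ 2 by psi_order R; lra.
have k1 : (1 + s ^+ 2) * s ^+ 2 = 1 by have s4 := psi4 R; ring: s4.
elim: n p => [p|n IH p] h1 h2.
  exists seed => //; exists (p.2, s ^+ 2 - p.1); last first.
    by rewrite app_seed [RHS]surjective_pairing /=; congr pair; ring.
  apply/beeE; right; have [_ _ /andP[? ?] /andP[? ?]] := psi_bounds R.
  by move: h1 h2; rewrite expr0 ler_norml /=; lra.
have kn : (1 + s ^+ 2) ^+ n / 3 = (1 + s ^+ 2) ^+ n.+1 / 3 * s ^+ 2.
  rewrite (exprSr _ n); move: (_ ^+ n) => A.
  by transitivity (A / 3 * ((1 + s ^+ 2) * s ^+ 2)); [rewrite k1 mulr1 | ring].
have [||t Pt rt] := IH (- p.1 * s ^+ 2, p.2 * s ^+ 2).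
- by rewrite /= normrM normrN (gtr0_norm k0) kn ler_pM2r.
- rewrite /=; case/andP: h2 => h2 h3; rewrite mulr_ge0 ?(ltW k0) //=.
  by rewrite kn ler_pM2r.
have [c tc rc] := (decompose_region t _).1 rt.
have [c' cc' rc'] := (decompose_region c _).1 rc.
exists (cmp grow c'); first by exists c' => //; exists c => //; exists t.
rewrite region_cmp; exists (- p.1 * s ^+ 2, p.2 * s ^+ 2) => //.
rewrite app_grow [RHS]surjective_pairing /=.
by congr pair; rewrite ?mulNr ?mulrN ?opprK mulrCA k1 mulr1.
Qed.

Lemma upper_cover p : 0 <= p.2 -> exists2 t, upper t & region t p.
Proof.
move=> p2; have k0 : 0 < s ^+ 2 by psi_order R; lra.
have bern n : 1 + n%:R * s ^+ 2 <= (1 + s ^+ 2) ^+ n.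
  elim: n => [|n IH]; first by rewrite mul0r addr0 expr0.
  rewrite (exprS _ n) -natr1; apply: le_trans (_ : (1 + s ^+ 2) * (1 + n%:R * s ^+ 2) <= _).
    have : 0 <= s ^+ 2 * (n%:R * s ^+ 2) by exact: mulr_ge0 (ltW k0) (mulr_ge0 (ler0n _ _) (ltW k0)).
    lra.
  by rewrite ler_pM2l //; lra.
pose y := 3 * `|p| / s ^+ 2; have y0 : 0 <= y.
  exact: divr_ge0 (mulr_ge0 (ler0n _ 3) (normr_ge0 p)) (ltW k0).
have /andP[_ hn] := truncn_itv y0; set n := (Num.trunc y).+1 in hn.
have hp : `|p| <= (1 + s ^+ 2) ^+ n / 3.
  move: hn; rewrite /y ltr_pdivrMr // => hn; have := bern n; lra.
have [||t Pt rt] := patch_cover (n := n) (p := p).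
- by apply: le_trans hp; rewrite prod_normE le_max lexx.
- by rewrite p2 (le_trans _ hp) // prod_normE le_max (ger0_norm p2) lexx orbT.
by exists t => //; exists n.
Qed.

End UpperHalfPlane.

(** * The arrows along the axis *)

Section Fault.
Variable R : realType.
Local Notation s := (psi R).
Implicit Types (p q v : R * R) (e f : arrow R) (t h c g : placement R).

Definition half_turn : placement R := Placement (0, 0) (-1, 0) false true.

Definition turn e : arrow R := map_arrow (app half_turn) e.

Lemma app_half_turn p : app half_turn p = (- p.1, - p.2).
Proof.
by rewrite /app /lin /flip_sign /= expr0 [LHS]surjective_pairing /=;
  congr pair; ring.
Qed.

Lemma ratio2_half_turn : ratio2 half_turn = 1.
Proof. by rewrite /ratio2 /=; ring. Qed.

Lemma turnK : involutive turn.
Proof.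
case=> [[[a b] [a' b']] i].
by rewrite /turn /map_arrow /source /target /= !app_half_turn /= !opprK.
Qed.

Definition on_axis e : Prop := (source e).2 = 0 /\ (target e).2 = 0.

(* The arrows of the upper half plane in [-1, 1] on the axis, where those of
   the lower half plane are obtained by a half turn. *)
Definition core : seq (arrow R) :=
  [:: ((-1, 0), (s ^+ 2 - 1, 0), 3%N);
      ((2 * s ^+ 2 - 1, 0), (s ^+ 2 - 1, 0), 3%N);
      ((s ^+ 2, 0), (2 * s ^+ 2 - 1, 0), 5%N);
      ((s ^+ 2, 0), (1, 0), 5%N)].

Definition outward : arrow R := ((1, 0), (1 + s ^+ 2, 0), 3%N).

Definition next_arrows e : seq (arrow R) :=
  map (map_arrow (app (grow R))) (flatten (map (@refine_arrow R) (refine_arrow e))).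

(** In the order of [core], the first arrow produces [outward] and the fourth, the second produces
    itself and the third, the third produces the first, and the fourth produces the half turn of
    [outward]. *)
Lemma next_core e0 e : e0 \in core -> e \in next_arrows e0 ->
  [\/ e \in core, e = outward | e = turn outward].
Proof.
move=> h0 h.
pose l := outward :: turn outward :: core.
have {h h0} : e \in flatten (map next_arrows core).
  by apply/flatten_mapP; exists e0.
have -> : flatten (map next_arrows core) =
    [seq nth ((0, 0), (0, 0), 0%N) l i | i <- [:: 0; 5; 3; 4; 2; 1]%N].
  rewrite /l /core /outward /turn /= /next_arrows /= /refine_arrow /= /map_arrow.
  rewrite !app_grow !app_half_turn /source /target /direction /=.
  have hs := psi4 R; do ?[congr cons]; do ?[congr pair];
    rewrite /= /GRing.scale /=; ring: hs.
move=> /(@subset_nth _ _ l) he; have {he} := he isT.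
rewrite !in_cons => /orP[/eqP ->|/orP[/eqP ->|]]; [by constructor 2|by constructor 3|].
by move=> ?; constructor 1.
Qed.

Lemma core_step : [/\ nth outward core 0 \in next_arrows (nth outward core 2) &
  nth outward core 3 \in next_arrows (nth outward core 0)].
Proof.
have hs := psi4 R.
have e0 : next_arrows (nth outward core 2) = [:: nth outward core 0].
  rewrite /next_arrows /= /refine_arrow /= /map_arrow !app_grow /source /target /=.
  by congr cons; do ?[congr pair]; ring: hs.
split; first by rewrite e0 mem_head.
have -> : next_arrows (nth outward core 0) = [:: outward; nth outward core 3].
  rewrite /next_arrows /= /refine_arrow /= /map_arrow !app_grow.
  rewrite /source /target /direction /=.
  by do ?[congr cons]; do ?[congr pair]; rewrite /= /GRing.scale /=; ring: hs.
by rewrite !in_cons eqxx orbT.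
Qed.

End Fault.

Section FaultArrows.
Variable R : realType.
Local Notation s := (psi R).
Implicit Types (p q v : R * R) (e f : arrow R) (t h c g : placement R).

Lemma refine_on_axis e0 e : e \in refine_arrow e0 -> on_axis e -> on_axis e0.
Proof.
have [k0 k1] : 0 < s ^+ 2 /\ s ^+ 2 < 1 by psi_order R; lra.
case: e0 => [[[a b] [a' b']] i]; rewrite /refine_arrow /on_axis; case: ifP => _;
  rewrite /direction /source /target /= ?in_cons in_nil orbF; last by move=> /eqP -> /=.
have k1' : 0 < 1 - s ^+ 2 by lra.
move=> /orP[] /eqP -> /=; rewrite /GRing.scale /= => -[e1 e2].
  move: e1; rewrite e2 add0r subr0 => /eqP; rewrite mulf_eq0 gt_eqF //= => /eqP.
  by split.
move: e2; rewrite e1 sub0r => e2; split=> //.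
by apply: (mulfI (lt0r_neq0 k1')); rewrite mulr0; lra.
Qed.

Lemma segment_snd e p : segment e p ->
  exists2 a : R, 0 <= a <= 1 & p = source e + a *: direction e /\
    p.2 = (1 - a) * (source e).2 + a * (target e).2.
Proof.
move=> /segmentP[a ha ->]; exists a => //; split=> //.
by rewrite /direction /= /GRing.scale /=; ring.
Qed.

(** The height along [e] is affine and nonnegative. It vanishes at two different parameters, hence
    everywhere. *)
Lemma overlap_on_axis e e' : 0 <= (source e).2 -> 0 <= (target e).2 ->
  (forall p, segment e' p -> p.2 <= 0) -> overlap e e' -> on_axis e.
Proof.
move=> h1 h2 h' [p [q [pq [pe /h' p0] [qe /h' q0]]]].
have [a /andP[a0 a1] [ep p2]] := segment_snd pe.
have [b /andP[b0 b1] [eq q2]] := segment_snd qe.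
have ab : a <> b by move=> ab; apply: pq; rewrite ep eq ab.
rewrite /on_axis; move: h1 h2 p2 q2; move: (source e).2 (target e).2 => y z y0 z0 p2 q2.
have ay : 0 <= (1 - a) * y by rewrite mulr_ge0 // subr_ge0.
have az : 0 <= a * z by rewrite mulr_ge0.
have by' : 0 <= (1 - b) * y by rewrite mulr_ge0 // subr_ge0.
have bz : 0 <= b * z by rewrite mulr_ge0.
have e1 : (1 - a) * y = 0 by lra.
have e2 : (1 - b) * y = 0 by lra.
have e3 : a * z = 0 by lra.
have e4 : b * z = 0 by lra.
have ba : a - b != 0 by rewrite subr_eq0; apply/eqP.
split; apply: (mulfI ba); rewrite mulr0; lra.
Qed.

Definition patch_arrow n e : Prop := exists2 t, patch n t & e \in arrows t.

Lemma patch_arrow_snd n e p : patch_arrow n e -> segment e p -> 0 <= p.2.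
Proof.
move=> [t Pt et] ep; apply: (patch_upper p Pt).1.
exact: (arrow_in_region ((legal_patch R _).1 _ Pt) et ep).1.
Qed.

(** Apply [decompose_arrow] twice. An arrow that is new in a subdivision has its midpoint inside a
    tile, at positive height, so an arrow on the axis is always inherited. *)
Lemma patch_arrow_step n e : patch_arrow n.+1 e -> on_axis e ->
  exists2 e0, patch_arrow n e0 /\ on_axis e0 & e \in next_arrows e0.
Proof.
move=> [_ [c [c1 [t Pt tc] cc] <-]]; rewrite arrows_cmp => /mapP[f hf ->].
have t0 := (legal_patch R n).1 _ Pt; have c10 := decompose_ratio2 t0 tc.
have c0 := decompose_ratio2 c10 cc.
have k0 : 0 < 1 + s ^+ 2 by psi_order R; lra.
move=> -[f1 f2]; have {}f1 : (app (grow R) (source f)).2 = 0 := f1.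
have {}f2 : (app (grow R) (target f)).2 = 0 := f2.
rewrite app_grow /= in f1; rewrite app_grow /= in f2.
have ff : on_axis f.
  by split; apply: (mulfI (lt0r_neq0 k0)); rewrite mulr0.
have st : source f <> target f.
  move=> st; have := arrow_direction_neq0 c0 hf; rewrite /direction st subrr eqxx.
  by [].
have no u c2 e' : (forall p, inner u p -> 0 < p.2) -> 0 < ratio2 u ->
    c2 \in decompose u -> e' \in arrows c2 -> source e' <> target e' -> on_axis e' ->
    exists2 e0, e0 \in arrows u & e' \in refine_arrow e0.
  move=> iu u0 cu ec ne [s0 t0']; have [//|h] := decompose_arrow u0 cu ec.
  have := iu _ (h _ _ ne (segment_source e') (segment_target e')).
  by rewrite /= s0 t0' /GRing.scale /= subr0 mulr0 addr0 ltxx.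
have [f1' hf1 ff1] := no c1 c f (fun p hp => (patch_upper p Pt).2 (decompose_inner tc hp))
  c10 cc hf st ff.
have st1 : source f1' <> target f1'.
  move=> st1; have := arrow_direction_neq0 c10 hf1; rewrite /direction st1 subrr eqxx.
  by [].
have af1 := refine_on_axis ff1 ff.
have [f0 hf0 ff0] := no t c1 f1' (fun p hp => (patch_upper p Pt).2 hp) t0 tc hf1 st1 af1.
exists f0; first by split; [exists t | exact: refine_on_axis ff0 af1].
by apply: map_f; apply/flatten_mapP; exists f1'.
Qed.

Lemma patch_arrow_next n e0 e : patch_arrow n e0 -> e \in next_arrows e0 ->
  patch_arrow n.+1 e.
Proof.
move=> [t Pt et] /mapP[f /flatten_mapP[f1 hf1 hf] ->].
have [c1 tc1 fc1] := decompose_refined et hf1.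
have [c cc fc] := decompose_refined fc1 hf.
exists (cmp (grow R) c); last by rewrite arrows_cmp map_f.
by exists c => //; exists c1 => //; exists t.
Qed.

Lemma next_arrows_sub e0 e : e \in next_arrows e0 ->
  segment e `<=` app (grow R) @` segment e0.
Proof.
move=> /mapP[f /flatten_mapP[f1 hf1 hf] ->]; rewrite segment_map.
by apply: image_subset => p /(refine_sub hf) /(refine_sub hf1).
Qed.

Lemma next_arrows_overlap e0 e e' : e \in next_arrows e0 -> e' \in next_arrows e0 ->
  overlap e e' -> e = e'.
Proof.
move=> /mapP[f /flatten_mapP[f1 hf1 hf] ->] /mapP[f' /flatten_mapP[f1' hf1' hf'] ->].
move=> /(overlap_map f f' (ratio2_grow_gt0 R)) o; congr map_arrow.
have e1 : f1 = f1'.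
  by apply: refine_overlap hf1 hf1' _; apply: overlap_sub o; exact: refine_sub.
by subst f1'; exact: refine_overlap hf hf' o.
Qed.

(** The growth is diagonal in the coordinates and so commutes with the half turn; the dividing
    points of an arrow move along with it. *)
Lemma turn_next_arrows e0 e : e \in next_arrows (turn e0) ->
  turn e \in next_arrows e0.
Proof.
move=> /mapP[f /flatten_mapP[f1]]; rewrite /turn refine_map => /mapP[g1 hg1 ->].
rewrite refine_map => /mapP[g hg ->] ->.
suff -> : map_arrow (app (half_turn R)) (map_arrow (app (grow R))
    (map_arrow (app (half_turn R)) g)) = map_arrow (app (grow R)) g.
  by apply: map_f; apply/flatten_mapP; exists g1.
case: g {hg} => [[[a b] [a' b']] i]; rewrite /map_arrow /source /target /=.
by rewrite !(app_half_turn, app_grow) /=; do ?[congr pair]; ring.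
Qed.

Definition unit_arrow : arrow R := ((-1, 0), (1, 0), 0%N).

Lemma unit_arrow_grow : segment unit_arrow `<=` app (grow R) @` segment unit_arrow.
Proof.
have k0 : 0 < s ^+ 2 by psi_order R; lra.
have k1 : (1 + s ^+ 2) * s ^+ 2 = 1 by have s4 := psi4 R; ring: s4.
move=> [x y] /segment_horiz /= [-> h]; exists (- x * s ^+ 2, 0).
  apply/segment_horiz; split=> //=; left.
  have h1 : -1 <= x <= 1 by case: h; lra.
  have k2 : s ^+ 2 < 1 by psi_order R; lra.
  by move: h1; move: (s ^+ 2) k0 k2 => k ? ? /andP[? ?]; apply/andP; split; nra.
rewrite app_grow /= mulr0; congr pair.
by transitivity ((1 + s ^+ 2) * s ^+ 2 * x); [ring | rewrite k1 mul1r].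
Qed.

Lemma outward_unit : ~ overlap (outward R) unit_arrow /\
  ~ overlap (turn (outward R)) unit_arrow.
Proof.
have k0 : 0 < s ^+ 2 by psi_order R; lra.
have tE : turn (outward R) = ((-1, 0), (- (1 + s ^+ 2), 0), 3%N).
  rewrite /turn /map_arrow /source /target /= !app_half_turn /= oppr0.
  by [].
rewrite tE; split=> -[[x y] [[x' y'] [pq [h1 h2] [h3 h4]]]]; apply: pq;
  move/segment_horiz: h1 => /= [-> h1]; move/segment_horiz: h2 => /= [_ h2];
  move/segment_horiz: h3 => /= [-> h3]; move/segment_horiz: h4 => /= [_ h4];
  congr pair; case: h1 => h1; case: h2 => h2; case: h3 => h3; case: h4 => h4; lra.
Qed.

Lemma outward_turn : ~ overlap (outward R) (turn (outward R)).
Proof.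
move=> o; have [+ _] := outward_unit; apply.
have k0 : 0 < s ^+ 2 by psi_order R; lra.
have tE : turn (outward R) = ((-1, 0), (- (1 + s ^+ 2), 0), 3%N).
  by rewrite /turn /map_arrow /source /target /= !app_half_turn /= oppr0.
case: o => p [q [pq [/segment_horiz /= [_ h1]]]]; rewrite tE.
by move=> /segment_horiz /= [_ h2]; case: h1 => h1; case: h2 => h2; lra.
Qed.

Lemma core_on_axis e : e \in core R -> on_axis e.
Proof. by rewrite /core; each_arrow. Qed.

Lemma core_unit e : e \in core R -> segment e `<=` segment unit_arrow.
Proof.
psi_order R; rewrite /core /unit_arrow; each_arrow => p;
  by rewrite !segment_horiz => -[-> h]; split=> //; left; case: h; lra.
Qed.

Lemma core_turn e : e \in core R -> turn e \notin core R.
Proof.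
move=> he; apply/negP => ht; have [f fe] : exists f, f = turn e by exists (turn e).
rewrite -fe in ht; psi_order R; move: he ht fe.
move=> /[dup] _ + hf; rewrite /core; each_arrow; rewrite /turn /map_arrow !app_half_turn;
  move: hf; rewrite /core; each_arrow; move=> -[*]; first [discriminate | lra].
Qed.

Lemma patch0_arrow e : patch_arrow 0 e -> on_axis e -> e \in core R.
Proof.
move=> [_ ->]; psi_order R; have s4 := psi4 R.
have ca : ((2 * s ^+ 2 - 1, 0), (s ^+ 2 - 1, 0), 3%N) \in core R.
  by rewrite /core !in_cons eqxx orbT.
have cb : ((s ^+ 2, 0), (2 * s ^+ 2 - 1, 0), 5%N) \in core R.
  by rewrite /core !in_cons eqxx !orbT.
rewrite /arrows /= /map_arrow !app_seed /source /target /=.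
have e1 : s ^+ 2 - s ^+ 4 = 2 * s ^+ 2 - 1 by lra.
rewrite subr0 e1; move: (core R) ca cb => K ca cb.
by each_arrow; rewrite /on_axis /source /target /= => -[? ?]; first [done | exfalso; lra].
Qed.

(** The growth maps [-1, 1] onto a larger interval, so the ancestor of an arrow overlapping [-1, 1]
    overlaps it too and is in [core] by induction. The only descendants of [core] outside [core] do
    not overlap [-1, 1]. *)
Lemma unit_arrow_core n e : patch_arrow n e -> on_axis e -> overlap e unit_arrow ->
  e \in core R.
Proof.
elim: n e => [|n IH] e Pe ae o; first exact: patch0_arrow.
have [e0 [Pe0 ae0] h0] := patch_arrow_step Pe ae.
have c0 : e0 \in core R.
  apply: IH => //; apply/(overlap_map e0 unit_arrow (ratio2_grow_gt0 R)).
  apply: overlap_sub o; rewrite segment_map; first exact: next_arrows_sub.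
  exact: unit_arrow_grow.
have [//|ee|ee] := next_core c0 h0; rewrite ee in o.
  by case: outward_unit => /(_ o).
by case: outward_unit => _ /(_ o).
Qed.

Lemma segment_turn e : segment (turn e) = app (half_turn R) @` segment e.
Proof. exact: segment_map. Qed.

Lemma turn_unit : segment (turn unit_arrow) `<=` segment unit_arrow.
Proof.
rewrite segment_turn => _ [p /segment_horiz /= [p2 hp] <-].
rewrite app_half_turn p2; apply/segment_horiz; rewrite /= oppr0; split=> //.
by case: hp; lra.
Qed.

Lemma overlap_turn e e' : overlap (turn e) (turn e') <-> overlap e e'.
Proof. by apply: overlap_map; rewrite ratio2_half_turn. Qed.

(** If the arrows overlap, so do their ancestors. Matching ancestors have matching parts, by
    [turn_next_arrows]. If both ancestors are in [core], the descendants are again in [core], or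
    they are [outward] and its half turn and match, and all mixed cases are excluded by position. *)
Lemma fault_overlap n e e' : patch_arrow n e -> on_axis e ->
  patch_arrow n e' -> on_axis e' -> overlap e (turn e') ->
  e = turn e' \/ e \in core R /\ e' \in core R.
Proof.
elim: n e e' => [|n IH] e e' Pe ae Pe' ae' o.
  by right; split; exact: patch0_arrow.
have [e0 [Pe0 ae0] h0] := patch_arrow_step Pe ae.
have [e0' [Pe0' ae0'] h0'] := patch_arrow_step Pe' ae'.
have sub_turn : segment (turn e') `<=` app (grow R) @` segment (turn e0').
  rewrite !segment_turn => _ [p /(next_arrows_sub h0') [q hq <-] <-].
  exists (app (half_turn R) q); first by exists q.
  by rewrite !(app_half_turn, app_grow) /=; congr pair; ring.
have [|ee|[c0 c0']] := IH e0 e0' Pe0 ae0 Pe0' ae0'.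
- apply/(overlap_map _ _ (ratio2_grow_gt0 R)).
  by apply: overlap_sub o; rewrite segment_map //; exact: next_arrows_sub.
- left; rewrite -[e]turnK; congr turn; apply: (next_arrows_overlap (e0 := e0')) => //.
    by apply: turn_next_arrows; rewrite -ee.
  by apply/overlap_turn; rewrite turnK.
have [ou1 ou2] := outward_unit.
have cu f : f \in core R -> segment f `<=` segment unit_arrow by exact: core_unit.
have ctu f : f \in core R -> segment (turn f) `<=` segment unit_arrow.
  move=> /cu hf; apply: subset_trans turn_unit; rewrite !segment_turn.
  exact: image_subset.
have [ce|ee|ee] := next_core c0 h0; have [ce'|ee'|ee'] := next_core c0' h0'.
- by right.
- by case: ou2; rewrite -ee'; apply: overlap_sub (overlap_sym o) => //; exact: cu.
- case: ou1; rewrite -[outward R]turnK -ee'; apply: overlap_sub (overlap_sym o) => //.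
  exact: cu.
- by case: ou1; rewrite -ee; apply: overlap_sub o => //; exact: ctu.
- by rewrite ee ee' in o; case: outward_turn.
- by left; rewrite ee ee' turnK.
- by case: ou2; rewrite -ee; apply: overlap_sub o => //; exact: ctu.
- by left; rewrite ee ee'.
- by rewrite ee ee' turnK in o; case: (outward_turn (overlap_sym o)).
Qed.

End FaultArrows.

(** * The tiling made of two half planes and its unmatched weight *)

Section FaultTiling.
Variable R : realType.
Local Notation s := (psi R).
Implicit Types (p q v : R * R) (e f : arrow R) (t h c g : placement R).
Implicit Types (x : arrow R * bool).

Definition turned t : placement R := cmp (half_turn R) t.

Definition fault_tiling : set (placement R) :=
  [set t | upper t \/ exists2 t0, upper t0 & t = turned t0].

Lemma turnedK : involutive turned.
Proof.
move=> [[a b] [a' b'] fl k]; rewrite /turned /cmp /=.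
congr (Placement _ _ _ _); rewrite ?app_half_turn /lin /flip_sign /= ?expr0 /=;
  congr pair; ring.
Qed.

Lemma sided_arrows_turned t :
  sided_arrows (turned t) = [seq (turn x.1, x.2) | x <- sided_arrows t].
Proof.
rewrite /sided_arrows -map_comp; apply: eq_map => -[e b] /=.
by rewrite /turn /map_arrow /source /target /= !app_cmp.
Qed.

Lemma fault_tiling_turned t : fault_tiling t -> fault_tiling (turned t).
Proof. by case=> [ut|[t0 u0 ->]]; [right; exists t|left; rewrite turnedK]. Qed.

Lemma upper_pos t p : upper t -> (region t p -> 0 <= p.2) /\ (inner t p -> 0 < p.2).
Proof. by move=> [n] /patch_upper; apply. Qed.

Lemma turned_neg t p : upper t ->
  (region (turned t) p -> p.2 <= 0) /\ (inner (turned t) p -> p.2 < 0).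
Proof.
move=> ut; rewrite region_cmp inner_cmp.
by split=> -[q hq <-]; rewrite app_half_turn /= ?oppr_le0 ?oppr_lt0;
  have := upper_pos q ut => -[h1 h2]; auto.
Qed.

Lemma fault_d_placement t : fault_tiling t -> d_placement s^-1 t.
Proof.
case=> [[n /patch_d_placement //]|[t0 [n /patch_d_placement h] ->]].
by rewrite /d_placement ratio2_cmp ratio2_half_turn mul1r.
Qed.

Lemma d_placement_bounds d t : d_placement d t ->
  (s * d) ^+ 2 <= ratio2 t <= d ^+ 2.
Proof.
move=> ->; have k1 : 0 <= s ^+ 2 <= 1 by psi_order R; lra.
have d2 := sqr_ge0 d; rewrite exprMn; case: (is_large t); rewrite ?mul1r ?lexx ?andbT //=.
  by rewrite ler_piMl //; case/andP: k1.
by rewrite ler_piMl //; case/andP: k1.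
Qed.

Lemma fault_plane_tiling : plane_tiling fault_tiling (s * s^-1) s^-1.
Proof.
have s0 := psi_gt0 R; split.
- rewrite mulfV ?gt_eqF // ltr01 /= invf_ge1 //.
  by have [_ ? _ _] := psi_bounds R; lra.
- by move=> t /fault_d_placement /d_placement_bounds.
- move=> t t' ht ht' neq.
  case: ht ht' => [ut|[t0 u0 e]] [ut'|[t0' u0' e']].
  + exact: ((legal_upper R).2 _ _ ut ut' neq).1.
  + by move=> p /(upper_pos p ut).2 h1; rewrite e' => /(turned_neg p u0').2 h2; lra.
  + by move=> p; rewrite e => /(turned_neg p u0).2 h2 /(upper_pos p ut').2 h1; lra.
  + rewrite e e'; apply: apart_map; first by rewrite ratio2_half_turn.
    by apply: ((legal_upper R).2 _ _ u0 u0' _).1 => e0; apply: neq; rewrite e e' e0.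
- move=> p; have [p0|p0] := leP 0 p.2.
    by have [t ut rt] := upper_cover p0; exists t => //; left.
  have [|t ut rt] := @upper_cover _ (app (half_turn R) p).
    by rewrite app_half_turn /= oppr_ge0 ltW.
  exists (turned t); first by right; exists t.
  rewrite region_cmp; exists (app (half_turn R) p) => //.
  by rewrite !app_half_turn /= !opprK; case: (p).
Qed.

Lemma upper_patch t t' : upper t -> upper t' -> exists n, patch n t /\ patch n t'.
Proof.
move=> [m Pt] [n Pt']; exists (maxn m n).
by split; [apply: patch_le Pt; exact: leq_maxl | apply: patch_le Pt'; exact: leq_maxr].
Qed.

Lemma fault_compatible t t' e e' : upper t -> upper t' -> e \in arrows t ->
  e' \in arrows (turned t') -> overlap e e' ->
  e = e' \/ e \in core R /\ turn e' \in core R.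
Proof.
move=> ut ut'; have [n [Pt Pt']] := upper_patch ut ut'.
move=> et; rewrite arrows_cmp => /mapP[f ft ->]; rewrite -/(turn f) turnK => o.
have Pe : patch_arrow n e by exists t.
have Pf : patch_arrow n f by exists t'.
have neg p : segment (turn f) p -> p.2 <= 0.
  rewrite segment_turn => -[q hq <-]; rewrite app_half_turn /= oppr_le0.
  exact: patch_arrow_snd Pf hq.
have pos p : segment e p -> 0 <= p.2 by exact: patch_arrow_snd Pe.
have posf p : segment f p -> 0 <= p.2 by exact: patch_arrow_snd Pf.
have ae : on_axis e.
  by apply: overlap_on_axis neg o; apply: pos; [exact: segment_source | exact: segment_target].
have af : on_axis f.
  have o' : overlap f (turn e) by apply/overlap_turn/overlap_sym; rewrite turnK.
  apply: overlap_on_axis _ o'; try (by apply: posf; [exact: segment_source]);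
    try (by apply: posf; [exact: segment_target]).
  move=> p; rewrite segment_turn => -[q hq <-]; rewrite app_half_turn /= oppr_le0.
  exact: pos.
exact: fault_overlap Pe ae Pf af o.
Qed.

(** The tile lies above the axis, which is the left of an arrow exactly if the arrow points to the
    right. *)
Lemma side_on_axis t e b : upper t -> (e, b) \in sided_arrows t -> on_axis e ->
  b = (0 < (direction e).1).
Proof.
move=> ut eb [s0 t0]; have a0 : 0 < (1 / 20 : R) < 1 / 10 by lra.
have := (upper_pos _ ut).2 (sided_arrows_side eb a0).
rewrite /midpoint /sideways /direction /= s0 t0 /GRing.scale /=.
by case: b {eb} => /= h; apply/esym; [|apply/negbTE; rewrite -leNgt]; lra.
Qed.

Definition turn_side x : arrow R * bool := (turn x.1, x.2).

Definition sided_core : seq (arrow R * bool) :=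
  [seq (e, 0 < (direction e).1) | e <- core R].

Definition fault_arrows : seq (arrow R * bool) :=
  sided_core ++ map turn_side sided_core.

Lemma sided_coreP x : x \in sided_core <->
  x.1 \in core R /\ x.2 = (0 < (direction x.1).1).
Proof.
split=> [/mapP[e he ->] //|[]]; case: x => e b /= he ->.
by apply/mapP; exists e.
Qed.

Lemma turn_sideK : involutive turn_side.
Proof. by case=> e b; rewrite /turn_side /= turnK. Qed.

Lemma uniq_fault_arrows : uniq fault_arrows.
Proof.
have uc : uniq (core R).
  psi_order R; rewrite /= !inE !negb_or; do ?[apply/andP; split] => //;
    apply/eqP => -[*]; first [discriminate | lra].
have us : uniq sided_core by rewrite map_inj_uniq // => e e' [].
rewrite cat_uniq us (map_inj_uniq (inv_inj turn_sideK)) us andbT.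
apply/hasPn => x /mapP[y /sided_coreP[cy _] ->]; apply/negP => /sided_coreP[].
by rewrite /= (negbTE (core_turn cy)).
Qed.

Lemma fault_arrows_turn x : (turn_side x \in fault_arrows) = (x \in fault_arrows).
Proof.
rewrite !mem_cat (mem_map (inv_inj turn_sideK)) orbC; congr orb.
by rewrite -{2}(turn_sideK x) (mem_map (inv_inj turn_sideK)).
Qed.

(** The half turn preserves norms and sides, so both halves contribute equally. In one half, color 5
    counts 0, and the two color 3 arrows end in the same point from opposite directions, which
    leaves 1 - (2 psi^2 - 1)^2. The total is 16 psi^2 - 8 > 0, for every [d]. *)
Lemma sum_fault_weight d : \sum_(x <- fault_arrows) weight d x != 0.
Proof.
have wt x : weight d (turn_side x) = weight d x.
  case: x => e b; rewrite /weight /=; congr (_ * _).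
  by rewrite /color /source /target /= /square_norm !app_half_turn /= !sqrrN.
have -> : \sum_(x <- fault_arrows) weight d x =
    \sum_(x <- sided_core) weight d x + \sum_(x <- sided_core) weight d x.
  rewrite [LHS]big_cat; congr (_ + _).
  by rewrite big_map; apply: eq_bigr => x _; exact: wt.
rewrite /sided_core /= !big_cons big_nil /weight /direction /source /target /= /square_norm /=.
psi_order R.
have -> : (0 < s ^+ 2 - 1 - -1) = true by apply/idP; lra.
have -> : (0 < s ^+ 2 - 1 - (2 * s ^+ 2 - 1)) = false by apply/negbTE; rewrite -leNgt; lra.
have s4 := psi4 R; apply/eqP; rewrite !expr1 !expr0 => h.
have : 2 - 2 * (2 * s ^+ 2 - 1) ^+ 2 = 0 by rewrite -[RHS]h; ring.
have -> : (2 * s ^+ 2 - 1) ^+ 2 = 5 - 8 * s ^+ 2 by ring: s4.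
lra.
Qed.

End FaultTiling.

Section Irreparable.
Variable R : realType.
Local Notation s := (psi R).
Implicit Types (p q v : R * R) (e f : arrow R) (t h c g : placement R).
Implicit Types (x : arrow R * bool).

(** The seed has only the second and third arrow of [core]. The first arises from the third in one
    step, and the fourth from the first in another. *)
Lemma core_upper e : e \in core R -> exists2 t, upper t & e \in arrows t.
Proof.
suff [h0 [h1 [h2 h3]]] : patch_arrow 1 (nth (outward R) (core R) 0) /\
    (patch_arrow 0 (nth (outward R) (core R) 1) /\
    (patch_arrow 0 (nth (outward R) (core R) 2) /\
     patch_arrow 2 (nth (outward R) (core R) 3))).
  have ex n f : patch_arrow n f -> exists2 t, upper t & f \in arrows t.
    by move=> [t Pt ft]; exists t => //; exists n.
  by move=> /(nthP (outward R)) [[|[|[|[|i]]]] // _ <-]; apply: ex;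
    [exact: h0 | exact: h1 | exact: h2 | exact: h3].
have hs := psi4 R.
have h2 : patch_arrow 0 (nth (outward R) (core R) 2).
  exists (seed R) => //; rewrite (_ : nth _ _ _ =
    map_arrow (app (seed R)) (nth (outward R) (base_arrows R false) 0)).
    by apply: map_f; exact: mem_nth.
  rewrite /= /map_arrow !app_seed /source /target /=.
  by do ?[congr pair]; ring: hs.
have h1 : patch_arrow 0 (nth (outward R) (core R) 1).
  exists (seed R) => //; rewrite (_ : nth _ _ _ =
    map_arrow (app (seed R)) (nth (outward R) (base_arrows R false) 1)).
    by apply: map_f; exact: mem_nth.
  rewrite /= /map_arrow !app_seed /source /target /=.
  by do ?[congr pair]; ring: hs.
have [n02 n30] := core_step R.
have h0 := patch_arrow_next h2 n02.
by split=> //; split=> //; split=> //; exact: patch_arrow_next h0 n30.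
Qed.

Lemma in_fault_turn x : in_tiling (@fault_tiling R) x ->
  in_tiling (@fault_tiling R) (turn_side x).
Proof.
move=> [t ht xt]; exists (turned t); first exact: fault_tiling_turned.
by rewrite sided_arrows_turned; apply: (map_f (fun x => (turn x.1, x.2))).
Qed.

Lemma other_side_turn x : other_side (turn_side x) = turn_side (other_side x).
Proof. by []. Qed.

Lemma turn_on_axis e : on_axis e -> on_axis (turn e).
Proof.
move=> [a1 a2]; split.
  by rewrite -[source _]/(app (half_turn R) (source e)) app_half_turn /= a1 oppr0.
by rewrite -[target _]/(app (half_turn R) (target e)) app_half_turn /= a2 oppr0.
Qed.

(** A tile of the upper half is on the wrong side. If a turned tile had the arrow, then the half
    turn of the arrow would be an axis arrow of the upper half within [-1, 1], hence in [core],
    against [core_turn]. *)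
Lemma fault_unmatched x : x \in fault_arrows R ->
  in_tiling (@fault_tiling R) x /\ ~ in_tiling (@fault_tiling R) (other_side x).
Proof.
wlog xc : x / x \in sided_core R => [wl|_].
  move=> hx; move: (hx); rewrite mem_cat => /orP[/wl|/mapP[y yc ey]]; first exact.
  have [|h1 h2] := wl y yc; first by rewrite mem_cat yc.
  rewrite ey; split; first exact: in_fault_turn.
  rewrite other_side_turn => /in_fault_turn; rewrite turn_sideK.
  exact: h2.
have [ce cb] := (sided_coreP x).1 xc; have ae := core_on_axis ce.
split.
  have [t ut et] := core_upper ce; have /sided_arrowsP[b eb] := et.
  exists t; first by left.
  by rewrite [x]surjective_pairing cb -(side_on_axis ut eb ae).
move=> [t [ut|[t0 u0 ->]]] xt.
  by have := side_on_axis ut xt ae; rewrite /= cb; case: (0 < _).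
move: xt; rewrite sided_arrows_turned => /mapP[y yt [e1 _]].
have y1 : y.1 = turn x.1 by rewrite e1 turnK.
have [n Pt] := u0.
have Py : patch_arrow n y.1.
  by exists t0 => //; apply/sided_arrowsP; exists y.2; rewrite -surjective_pairing.
have ay : on_axis y.1.
  by rewrite y1; exact: turn_on_axis.
have oy : overlap y.1 (unit_arrow R).
  exists (source y.1), (target y.1).
  have cu p : segment y.1 p -> segment (unit_arrow R) p.
    rewrite y1 => hp; apply: turn_unit; move: hp; rewrite !segment_turn.
    by case=> q hq <-; exists q => //; exact: core_unit hq.
  split; first last.
  - by split; [exact: segment_target | apply: cu; exact: segment_target].
  - by split; [exact: segment_source | apply: cu; exact: segment_source].
  - move=> st; have [t' Pt' yt'] := Py.
    have := arrow_direction_neq0 ((legal_patch R n).1 _ Pt') yt'.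
    by rewrite /direction st subrr eqxx.
have := unit_arrow_core Py ay oy.
by rewrite y1 (negbTE (core_turn ce)).
Qed.

Lemma fault_matched x : x \notin fault_arrows R ->
  in_tiling (@fault_tiling R) x -> in_tiling (@fault_tiling R) (other_side x).
Proof.
move=> xD [t ht xt].
wlog ut : x t xD ht xt / upper t => [wl|].
  case: (ht) => [ut|[t0 u0 et]]; first exact: (wl x t).
  rewrite -(turn_sideK x) other_side_turn; apply: in_fault_turn.
  apply: (wl _ t0) => //; first by rewrite fault_arrows_turn.
    by left.
  by move: xt; rewrite et sided_arrows_turned => /mapP[y yt ->]; rewrite turn_sideK.
have et : x.1 \in arrows t.
  by apply/sided_arrowsP; exists x.2; rewrite -surjective_pairing.
apply: partner_side (@fault_plane_tiling R) (ht) (xt) _ => t' e' ht' nt et' o.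
case: ht' nt et' => [ut'|[t0 u0 ->]] nt et'.
  exact: ((legal_upper R).2 _ _ ut ut' (nesym nt)).2.
have [//|[ce _]] := fault_compatible ut u0 et et' o.
case/negP: xD; rewrite mem_cat; apply/orP; left; apply/sided_coreP; split=> //.
apply: side_on_axis (ut) _ (core_on_axis ce).
by rewrite -surjective_pairing.
Qed.

Lemma fault_infinite_difference P' : plane_tiling P' (s * s^-1) s^-1 ->
  (forall t, P' t -> d_placement s^-1 t) ->
  (forall t t', P' t -> P' t' -> t <> t' -> compatible t t') ->
  infinite_set (@fault_tiling R `\` P').
Proof.
move=> hP' dP' cP' fin; have := sum_fault_weight s^-1.
rewrite (unmatched_weight (@fault_plane_tiling R) hP' (@fault_d_placement R) dP' cP'
  (uniq_fault_arrows R) fault_unmatched fault_matched fin).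
by rewrite eqxx.
Qed.

End Irreparable.

(** * Every similarity is given by a placement *)

Section Similarities.
Variable R : realType.
Local Notation s := (psi R).
Implicit Types (p q v : R * R) (t h c g : placement R).

Definition dist2 p q : R := (p.1 - q.1) ^+ 2 + (p.2 - q.2) ^+ 2.

Lemma dist2_ge0 p q : 0 <= dist2 p q.
Proof. by rewrite addr_ge0 ?sqr_ge0. Qed.

Lemma dist2_app t p q : dist2 (app t p) (app t q) = ratio2 t * dist2 p q.
Proof. by have := lin_norm t (p - q); rewrite -app_sub. Qed.

Lemma similarity_app t (r : R) : 0 < r -> ratio2 t = r ^+ 2 -> similarity r (app t).
Proof.
move=> r0 tr; split=> // p q; rewrite /eucl_dist -!/(dist2 _ _) dist2_app tr.
by rewrite sqrtrM ?sqr_ge0 // sqrtr_sqr gtr0_norm.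
Qed.

Lemma similarity_dist2 (r : R) (f : R * R -> R * R) p q : similarity r f ->
  dist2 (f p) (f q) = r ^+ 2 * dist2 p q.
Proof.
move=> [r0 /(_ p q)]; rewrite /eucl_dist -!/(dist2 _ _) => e.
by rewrite -(sqr_sqrtr (dist2_ge0 (f p) (f q))) e exprMn sqr_sqrtr ?dist2_ge0.
Qed.

(** The images of (0, 0), (1, 0) and (0, 1) determine [f], because the distances to them give scalar
    products with [u] and [v]. These two vectors are orthogonal of length [r], so their determinant
    [w] is [r ^+ 2] up to a sign, and this sign is the flip. *)
Lemma similarity_placement (r : R) (f : R * R -> R * R) (k : bool) :
  similarity r f -> exists t, [/\ f = app t, ratio2 t = r ^+ 2 & is_large t = k].
Proof.
move=> sf; have r0 : 0 < r by case: sf.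
have d p q := similarity_dist2 p q sf.
pose a := f (0, 0); pose u := f (1, 0) - a; pose v := f (0, 1) - a.
have hr : r ^+ 2 != 0 by rewrite expf_neq0 ?gt_eqF.
have hu : u.1 ^+ 2 + u.2 ^+ 2 = r ^+ 2.
  by have := d (1, 0) (0, 0); rewrite /dist2 /= => e; rewrite -[RHS]mulr1 /u /= e; ring.
have hv : v.1 ^+ 2 + v.2 ^+ 2 = r ^+ 2.
  by have := d (0, 1) (0, 0); rewrite /dist2 /= => e; rewrite -[RHS]mulr1 /v /= e; ring.
have huv : u.1 * v.1 + u.2 * v.2 = 0.
  have := d (1, 0) (0, 1); rewrite /dist2 /=; move: hu hv; rewrite /u /v /=; lra.
pose w := u.1 * v.2 - u.2 * v.1.
have [fl hw] : exists fl : bool, w = (-1) ^+ fl * r ^+ 2.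
  have : w ^+ 2 = (r ^+ 2) ^+ 2.
    transitivity ((u.1 ^+ 2 + u.2 ^+ 2) * (v.1 ^+ 2 + v.2 ^+ 2)
      - (u.1 * v.1 + u.2 * v.2) ^+ 2); first by rewrite /w; ring.
    by rewrite hu hv huv; ring.
  move=> /eqP; rewrite eqf_sqr => /orP[] /eqP ->; [exists false|exists true].
    by rewrite expr0 mul1r.
  by rewrite expr1 mulN1r.
have v1 : v.1 = - (-1) ^+ fl * u.2.
  apply: (mulfI hr); transitivity (u.1 * (u.1 * v.1 + u.2 * v.2) - u.2 * w).
    by rewrite -hu /w; ring.
  by rewrite huv hw; ring.
have v2 : v.2 = (-1) ^+ fl * u.1.
  apply: (mulfI hr); transitivity (u.2 * (u.1 * v.1 + u.2 * v.2) + u.1 * w).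
    by rewrite -hu /w; ring.
  by rewrite huv hw; ring.
exists (Placement a u fl k); split=> //; apply/funext=> -[x y].
have e2 : ((-1) ^+ fl) ^+ 2 = 1 :> R by exact: sqrr_sign.
pose z := f (x, y) - a.
have z0 : z.1 ^+ 2 + z.2 ^+ 2 = r ^+ 2 * (x ^+ 2 + y ^+ 2).
  by have := d (x, y) (0, 0); rewrite /dist2 /= !subr0.
have zu : z.1 * u.1 + z.2 * u.2 = r ^+ 2 * x.
  have := d (x, y) (1, 0); rewrite /dist2 /=; move: z0 hu; rewrite /z /u /=; lra.
have zv : z.1 * v.1 + z.2 * v.2 = r ^+ 2 * y.
  have := d (x, y) (0, 1); rewrite /dist2 /=; move: z0 hv; rewrite /z /v /=; lra.
have fz : f (x, y) = a + z by rewrite /z addrC subrK.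
clearbody z w v u; rewrite fz /app /=; congr (_ + _); rewrite /lin /flip_sign [LHS]surjective_pairing /=.
have zw : z.2 * u.1 - z.1 * u.2 = (-1) ^+ fl * (r ^+ 2 * y).
  by rewrite -zv v1 v2; ring: e2.
congr pair; apply: (mulfI hr).
  transitivity (u.1 * (z.1 * u.1 + z.2 * u.2) - u.2 * (z.2 * u.1 - z.1 * u.2)).
    by rewrite -hu; ring.
  by rewrite zu zw; ring.
transitivity (u.2 * (z.1 * u.1 + z.2 * u.2) + u.1 * (z.2 * u.1 - z.1 * u.2)).
  by rewrite -hu; ring.
by rewrite zu zw; ring.
Qed.

End Similarities.

(** * The hexagon has no symmetry: a tile determines its placement *)

Section Uniqueness.
Variable R : realType.
Local Notation s := (psi R).
Implicit Types (p q v : R * R) (t h c g : placement R).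

Let cO : R * R := (0, 0).
Let cA : R * R := (0, 1).
Let cB : R * R := (s, 0).

Lemma sqr_diff_le (x y b : R) : 0 <= x <= b -> 0 <= y <= b -> (x - y) ^+ 2 <= b ^+ 2.
Proof.
move=> hx hy; have b0 : 0 <= b by lra.
by rewrite -[leLHS]real_normK ?num_real // ler_sqr ?nnegrE // ler_norml; lra.
Qed.

Lemma sqr_diff_eq (x y b : R) : 0 < b -> 0 <= x <= b -> 0 <= y <= b ->
  b ^+ 2 <= (x - y) ^+ 2 -> x = b /\ y = 0 \/ x = 0 /\ y = b.
Proof.
move=> b0 hx hy; rewrite -[leRHS]real_normK ?num_real // ler_sqr ?nnegrE ?(ltW b0) //.
by rewrite ler_normr => /orP[] h; [left|right]; lra.
Qed.

(* The diameter of the hexagon is attained only at (0, 1) and (psi, 0). *)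
Lemma bee_diameter p q : bee R p -> bee R q -> dist2 p q <= 1 + s ^+ 2 /\
  (1 + s ^+ 2 <= dist2 p q -> p = cA /\ q = cB \/ p = cB /\ q = cA).
Proof.
wlog hor : p q / 0 <= p.2 <= s ^+ 2 /\ 0 <= p.1 <= s => [wl|].
  move=> bp bq; have /beeE[[h1 h2]|[h1 h2]] := bp; first exact: wl.
  have /beeE[[h3 h4]|[h3 h4]] := bq.
    have [w1 w2] := wl q p (conj h4 h3) bq bp.
    have dC : dist2 p q = dist2 q p by rewrite /dist2 -sqrrN opprB -[X in _ + X]sqrrN opprB.
    by rewrite dC; split=> // /w2 [[-> ->]|[-> ->]]; [right|left].
  have d1 := sqr_diff_le h1 h3; have d2 := sqr_diff_le h2 h4.
  have k : (s ^+ 3) ^+ 2 < s ^+ 2.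
    have [_ s6 _ _] := psi_powers R; have e : (s ^+ 3) ^+ 2 = s ^+ 6 by ring.
    by rewrite e s6; psi_order R; lra.
  by rewrite expr1n in d2; rewrite /dist2; split=> [|?]; [|exfalso]; lra.
move=> bp bq; case: hor => hp2 hp1; have s0 := psi_gt0 R.
have hq1 : 0 <= q.1 <= s by move/beeE: bq; psi_order R => -[] [? ?]; lra.
have [_ q2] := bee_unit bq; have [_ p2] := bee_unit bp.
have d1 := sqr_diff_le hp1 hq1; have d2 := sqr_diff_le p2 q2.
rewrite expr1n in d2.
rewrite /dist2; split=> [|ge]; first lra.
have e1 : s ^+ 2 <= (p.1 - q.1) ^+ 2 by lra.
have e2 : 1 ^+ 2 <= (p.2 - q.2) ^+ 2 by rewrite expr1n; lra.
have := sqr_diff_eq s0 hp1 hq1 e1; have := sqr_diff_eq ltr01 p2 q2 e2.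
move: hp2; psi_order R => hp2 h2 h1.
have [p20 q21] : p.2 = 0 /\ q.2 = 1 by case: h2; lra.
have q1 : q.1 <= s ^+ 3 by move/beeE: bq; rewrite q21 => -[] [? ?]; lra.
have [p1s q10] : p.1 = s /\ q.1 = 0 by case: h1; lra.
by right; rewrite [p]surjective_pairing [q]surjective_pairing p20 q21 p1s q10.
Qed.

(** The two circles also meet in the mirror image of the corner in the line through [cA] and [cB].
    Its abscissa 2 psi^3 exceeds psi. *)
Lemma bee_corner p : bee R p -> dist2 p cA = 1 -> dist2 p cB = s ^+ 2 -> p = cO.
Proof.
move=> /beeE bp; rewrite /dist2 /= => h1 h2; have s4 := psi4 R; psi_order R.
have e : p.2 = s * p.1 by move: h1 h2; lra.
have : p.1 * (p.1 * (1 + s ^+ 2) - 2 * s) = 0.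
  transitivity ((p.1 - 0) ^+ 2 + (s * p.1 - 1) ^+ 2 - 1); first by ring.
  by rewrite -e h1 subrr.
move=> /eqP; rewrite mulf_eq0 => /orP[/eqP p1|/eqP p1].
  by rewrite [p]surjective_pairing e p1 mulr0.
exfalso; have : p.1 = 2 * s ^+ 3.
  have k : (1 + s ^+ 2) * s ^+ 2 = 1 by ring: s4.
  transitivity (p.1 * (1 + s ^+ 2) * s ^+ 2); first by rewrite -mulrA k mulr1.
  by rewrite (_ : p.1 * (1 + s ^+ 2) = 2 * s); [ring|lra].
have [? ? /andP[? ?] /andP[? ?]] := psi_bounds R; case: bp => -[? ?]; lra.
Qed.

(** The circles meet in (psi, 1) and in a point with the negative abscissa psi^5 - psi^3. This
    prevents an exchange of the two ends of the diameter. *)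
Lemma bee_no_corner p : bee R p -> dist2 p cB = 1 -> dist2 p cA = s ^+ 2 -> False.
Proof.
move=> /beeE bp; rewrite /dist2 /= => h1 h2; have s4 := psi4 R.
have e : p.2 = s * p.1 + 1 - s ^+ 2 by move: h1 h2; lra.
have k : (1 + s ^+ 2) * s ^+ 2 = 1 by ring: s4.
have : (p.1 - s) * (p.1 - (s ^+ 5 - s ^+ 3)) = 0.
  transitivity (s ^+ 2 * (((p.1 - 0) ^+ 2 + (p.2 - 1) ^+ 2) - s ^+ 2)).
    rewrite e; ring: s4.
  by rewrite h2 subrr mulr0.
have [s5 _ _ _] := psi_powers R; psi_order R.
have : s < 2 * s ^+ 3 by have [? ? /andP[? ?] /andP[? ?]] := psi_bounds R; lra.
move=> ? /eqP; rewrite mulf_eq0 !subr_eq0 => /orP[] /eqP p1; rewrite p1 ?s5 in e bp.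
  have p2 : p.2 = 1 by rewrite e; ring.
  by case: bp => -[? ?]; lra.
by case: bp => -[? ?]; lra.
Qed.

(** Comparing diameters in both directions gives equal ratios. Then the ends of the diameter
    correspond, without exchange, and so does the corner (0, 0). These three points fix origin, axis
    and flip. *)
Lemma region_inj t t' : 0 < ratio2 t -> 0 < ratio2 t' -> region t = region t' ->
  [/\ origin t = origin t', axis t = axis t' & flipped t = flipped t'].
Proof.
have s0 := psi_gt0 R; have [s1 s2] : 0 < s ^+ 2 /\ s ^+ 2 < s by psi_order R; lra.
have s3 : s < 1 by psi_order R.
have bO : bee R cO by apply/beeE; left; rewrite /=; psi_order R; lra.
have bA : bee R cA by apply/beeE; right; rewrite /=; psi_order R; lra.
have bB : bee R cB by apply/beeE; left; rewrite /=; lra.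
have dAB : dist2 cA cB = 1 + s ^+ 2 by rewrite /dist2 /=; ring.
have dOA : dist2 cO cA = 1 by rewrite /dist2 /=; ring.
have dOB : dist2 cO cB = s ^+ 2 by rewrite /dist2 /=; ring.
have D0 : 0 < 1 + s ^+ 2 by lra.
have half (u u' : placement R) : region u = region u' -> 0 < ratio2 u' -> ratio2 u <= ratio2 u'.
  move=> e u0; have [a ba ea] : region u' (app u cA) by rewrite -e; exists cA.
  have [b bb eb] : region u' (app u cB) by rewrite -e; exists cB.
  have := dist2_app u cA cB; rewrite -ea -eb dist2_app dAB => e'.
  rewrite -(ler_pM2r D0) -e' ler_pM2l //; exact: (bee_diameter ba bb).1.
move=> t0 t0' e; have r : ratio2 t = ratio2 t'.
  by apply/eqP; rewrite eq_le !half.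
have [a ba ea] : region t' (app t cA) by rewrite -e; exists cA.
have [b bb eb] : region t' (app t cB) by rewrite -e; exists cB.
have [z bz ez] : region t' (app t cO) by rewrite -e; exists cO.
have t'n0 : ratio2 t' != 0 by rewrite gt_eqF.
have dd p q p' q' : app t' p = app t p' -> app t' q = app t q' ->
    dist2 p q = dist2 p' q'.
  by move=> e1 e2; apply: (mulfI t'n0); rewrite -dist2_app e1 e2 dist2_app r.
have dab := dd _ _ _ _ ea eb; have doa := dd _ _ _ _ ez ea; have dob := dd _ _ _ _ ez eb.
rewrite dAB in dab; rewrite dOA in doa; rewrite dOB in dob.
have [|[aA bB']|[aB bA']] := (bee_diameter ba bb).2; first by rewrite dab.
  rewrite aA in doa ea; rewrite bB' in dob eb.
  have oO := bee_corner bz doa dob; rewrite oO in ez.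
  have eor : origin t = origin t'.
    move: ez; rewrite /app /lin /= !mulr0 subrr addr0.
    by move=> /esym; rewrite -[(0, 0)]/(0 : R * R) !addr0.
  have eax : axis t = axis t'.
    have : lin t' cB = lin t cB.
      by move: eb; rewrite /app eor => /addrI.
    rewrite /lin /= !mulr0 !subr0 !addr0 => -[x1 x2].
    have sn : s != 0 by rewrite gt_eqF.
    by rewrite [axis t]surjective_pairing [axis t']surjective_pairing
      (mulIf sn x1) (mulIf sn x2).
  split=> //.
  have : lin t' cA = lin t cA by move: ea; rewrite /app eor => /addrI.
  rewrite /lin /= !mulr0 !mulr1 !sub0r !add0r eax => -[/oppr_inj x1 x2].
  have : (flip_sign t' - flip_sign t) * ratio2 t' = 0.
    rewrite /ratio2; transitivity
      ((flip_sign t' * (axis t').1 - flip_sign t * (axis t').1) * (axis t').1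
      + (flip_sign t' * (axis t').2 - flip_sign t * (axis t').2) * (axis t').2).
      by ring.
    by rewrite x1 x2 !subrr !mul0r addr0.
  move/eqP; rewrite mulf_eq0 (negbTE t'n0) orbF subr_eq0 /flip_sign => /eqP.
  case: (flipped t); case: (flipped t') => //; rewrite expr0 expr1; lra.
rewrite aB in doa; rewrite bA' in dob.
by case: (bee_no_corner bz doa dob).
Qed.

Lemma d_placement_gt0 d t : d != 0 -> d_placement d t -> 0 < ratio2 t.
Proof.
move=> d0 ->; have s0 := psi_gt0 R.
by rewrite mulr_gt0 ?exprn_even_gt0 //; case: ifP; rewrite ?exprn_gt0.
Qed.

Lemma d_placement_region_inj d t t' : d != 0 -> d_placement d t -> d_placement d t' ->
  region t = region t' -> t = t'.
Proof.
move=> d0 dt dt' e.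
have [eo ea ef] := region_inj (d_placement_gt0 d0 dt) (d_placement_gt0 d0 dt') e.
have ek : is_large t = is_large t'.
  have d2 : d ^+ 2 != 0 by rewrite expf_neq0.
  move: dt dt'; rewrite /d_placement /ratio2 ea => -> /(mulIf d2).
  have k1 : s ^+ 2 <> 1 by psi_order R; lra.
  by case: (is_large t); case: (is_large t') => // h; case: k1.
by case: t t' eo ea ef ek {dt dt' e} => [? ? ? ?] [? ? ? ?] /= -> -> -> ->.
Qed.

End Uniqueness.

(** * Translation between tiles as sets and placements *)

Section TilesAndPlacements.
Variable R : realType.
Local Notation s := (psi R).
Implicit Types (p q v : R * R) (e : arrow R) (t h c g : placement R) (X : set (R * R)).
Variable d : R.
Hypothesis d0 : 0 < d.

Let dn0 : d != 0.
Proof. by rewrite gt_eqF. Qed.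

Let sd0 : 0 < s * d.
Proof. by rewrite mulr_gt0 // psi_gt0. Qed.

Lemma placement_similarity t : d_placement d t ->
  similarity (if is_large t then d else s * d) (app t).
Proof.
rewrite /d_placement => h; apply: similarity_app; first by case: ifP.
by rewrite h; case: ifP; rewrite ?mul1r // exprMn.
Qed.

Lemma similarity_d_placement (k : bool) f :
  similarity (if k then d else s * d) f ->
  exists t, [/\ f = app t, d_placement d t & is_large t = k].
Proof.
move=> /(similarity_placement k) [t [-> h1 h2]]; exists t; split=> //.
by rewrite /d_placement h1 h2; case: ifP; rewrite ?mul1r // exprMn.
Qed.

Lemma d_tile_placement X : d_tile d X <-> exists2 t, d_placement d t & region t = X.
Proof.
split.
  move=> [[f sf ->]|[f sf ->]].
    have [t [-> dt _]] := similarity_d_placement (k := true) sf.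
    by exists t.
  have [t [-> dt _]] := similarity_d_placement (k := false) sf.
  by exists t.
move=> [t /placement_similarity st <-]; move: st; case: ifP => _ st; [left|right];
  by exists (app t).
Qed.

(** [tile_arrows] ranges over all similarities onto the tile and over both kinds; by uniqueness of
    the placement only one of them remains. *)
Lemma tile_arrows_placement t e : d_placement d t ->
  tile_arrows d (region t) e <-> e \in arrows t.
Proof.
move=> dt; split.
  have key (k : bool) f e0 : similarity (if k then d else s * d) f ->
      region t = f @` bee R -> e0 \in base_arrows R k -> map_arrow f e0 \in arrows t.
    move=> sf rt he0; have [t1 [ef dt1 kt1]] := similarity_d_placement sf.
    have -> : t = t1.
      by apply: (d_placement_region_inj dn0 dt dt1); rewrite rt ef.
    by rewrite ef /arrows kt1; exact: map_f.
  by move=> [f [[sf rt [e0 he0 ->]]|[sf rt [e0 he0 ->]]]];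
    [exact: (key true) | exact: (key false)].
move=> /mapP[e0 he0 ->]; exists (app t); have := placement_similarity dt.
by move: he0; case: (is_large t) => he0 st; [left|right]; split=> //; exists e0.
Qed.

Lemma arrow_compatible_placement t t' : d_placement d t -> d_placement d t' ->
  arrow_compatible d (region t) (region t') <-> compatible t t'.
Proof.
move=> dt dt'; split=> h e e'.
  move=> et et' o; have te := (tile_arrows_placement e dt).2 et.
  have te' := (tile_arrows_placement e' dt').2 et'.
  by have [h1 h2 h3] := h e e' te te' o; exact: segment_eq_arrow.
by move=> /(tile_arrows_placement e dt) et /(tile_arrows_placement e' dt') et' o;
  rewrite (h e e' et et' o).
Qed.

Definition placements (T : set (set (R * R))) : set (placement R) :=
  [set t | T (region t) /\ d_placement d t].

Lemma placements_plane_tiling T : d_tiling d T -> of_plane T ->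
  plane_tiling (placements T) (s * d) d.
Proof.
move=> [_ _ tT trivT] cover; split.
- by rewrite sd0 /= ler_piMl ?(ltW d0) //; psi_order R; lra.
- by move=> t [_ /d_placement_bounds].
- move=> t t' [Tt dt] [Tt' dt'] neq p ip ip'; apply: neq.
  apply: (d_placement_region_inj dn0 dt dt'); apply: trivT => //.
  exists p; split; rewrite interior_region //; exact: d_placement_gt0 dn0 _.
- move=> p; have : [set: R * R] p by []; rewrite -cover => -[X TX Xp].
  have [t dt rt] := (d_tile_placement X).1 (tT X TX).
  by exists t; [split; rewrite ?rt|rewrite rt].
Qed.

Lemma placements_compatible T : arrow_rule d T -> forall t t',
  placements T t -> placements T t' -> t <> t' -> compatible t t'.
Proof.
move=> rule t t' [Tt dt] [Tt' dt'] neq; apply/(arrow_compatible_placement dt dt').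
apply: rule => // e; apply: neq; exact: d_placement_region_inj dn0 dt dt' e.
Qed.

End TilesAndPlacements.

(** * Infinitely many tiles of each kind *)

Section Unbounded.
Variable R : realType.
Local Notation s := (psi R).
Implicit Types (p q v : R * R) (e : arrow R) (t h c g : placement R).

Lemma inv_psi_gt0 : 0 < s^-1.
Proof. by rewrite invr_gt0 psi_gt0. Qed.

Lemma fault_dist t p q : fault_tiling t -> region t p -> region t q ->
  `|p.1 - q.1| <= 2 * s^-1 /\ `|p.2 - q.2| <= 2 * s^-1.
Proof.
move=> /fault_d_placement /d_placement_bounds /andP[_ h] [p' bp <-] [q' bq <-].
exact: app_dist (ltW inv_psi_gt0) h bp bq.
Qed.

(** The first subdivision of any tile yields a large tile, and the second splits this into one tile
    of each kind. *)
Lemma upper_kind (k : bool) t : upper t ->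
  exists c, [/\ upper (cmp (grow R) c), is_large c = k & region c `<=` region t].
Proof.
move=> [n Pt].
have [c1 tc1 k1] : exists2 c1, c1 \in decompose t & is_large c1.
  rewrite /decompose; case: (is_large t) => /=.
    by exists (cmp t (long_piece R)); rewrite ?in_cons ?eqxx.
  by exists (cmp t (whole_piece R)); rewrite ?in_cons ?eqxx.
have [c cc kc] : exists2 c, c \in decompose c1 & is_large c = k.
  rewrite /decompose k1 /=; case: k.
    by exists (cmp c1 (long_piece R)); rewrite ?in_cons ?eqxx.
  by exists (cmp c1 (short_piece R)); rewrite ?in_cons ?eqxx ?orbT.
exists c; split=> //; last by move=> p /(decompose_sub cc) /(decompose_sub tc1).
by exists n.+1; exists c => //; exists c1 => //; exists t.
Qed.

Lemma infinite_kind (k : bool) :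
  infinite_set [set region t | t in [set t : placement R | upper t /\ is_large t = k]].
Proof.
move=> /finite_seqP[l el].
have [M hM] : exists M, forall X, X \in l -> forall p, X p -> p.2 <= M.
  have bdd X : exists M, (exists2 t, upper t & region t = X) ->
      forall p, X p -> p.2 <= M.
    have [[t ut <-]|no] := pselect (exists2 t, upper t & region t = X); last first.
      by exists 0 => h; case: no.
    exists ((app t 0).2 + 2 * s^-1) => _ p tp.
    have t0 : region t (app t 0).
      by exists 0 => //; apply/beeE; left; rewrite /=; psi_order R; lra.
    by have [_] := fault_dist (or_introl ut) tp t0; rewrite ler_norml; lra.
  have up X : X \in l -> exists2 t, upper t & region t = X.
    move=> Xl; have : [set` l] X by []; rewrite -el => -[t [ut _] rt].
    by exists t.
  have [f hf] := choice bdd.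
  exists (\sum_(X <- l) `|f X|) => X Xl p Xp.
  apply: le_trans (hf X (up X Xl) p Xp) _; apply: le_trans (ler_norm _) _.
  by rewrite (big_rem X) //= lerDl sumr_ge0.
(* Heights within a tile differ by at most [2 * s^-1], so the tile through (0, y) stays above [M].
   Its pieces do as well, and the growth only raises them. *)
pose y := `|M| + 2 * s^-1 + 1.
have i0 := inv_psi_gt0; have y0 : 0 <= y by rewrite /y; have := normr_ge0 M; lra.
have [t ut rt] := @upper_cover R (0, y) y0.
have [c [uc kc sub]] := upper_kind k ut.
have [q rq] : exists q, region c q.
  by exists (app c 0); exists 0 => //; apply/beeE; left; rewrite /=; psi_order R; lra.
have [_ dy] := fault_dist (or_introl ut) rt (sub _ rq).
have Xl : region (cmp (grow R) c) \in l.
  have : [set region t | t in [set t : placement R | upper t /\ is_large t = k]]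
      (region (cmp (grow R) c)) by exists (cmp (grow R) c).
  by rewrite el.
have gq : region (cmp (grow R) c) (app (grow R) q) by rewrite region_cmp; exists q.
have := hM _ Xl _ gq; rewrite app_grow /=.
have hq : `|M| + 1 <= q.2 by move: dy; rewrite ler_norml /= /y; lra.
have := ler_norm M; have := normr_ge0 M => ? ?.
have : 0 <= s ^+ 2 * q.2 by rewrite mulr_ge0 ?sqr_ge0 //; lra.
lra.
Qed.

End Unbounded.

(** * The tiling as a set of tiles, and the conclusion *)

Section FaultTiles.
Variable R : realType.
Local Notation s := (psi R).
Implicit Types (p q v : R * R) (e : arrow R) (t h c g : placement R).
Local Notation d := (s^-1).

Definition fault_tiles : set (set (R * R)) := [set region t | t in @fault_tiling R].

Lemma fault_d_tiling : d_tiling d fault_tiles.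
Proof.
have d0 := inv_psi_gt0 R; have [_ _ ap _] := fault_plane_tiling R.
split=> //.
- by exists (region (seed R)), (seed R) => //; left; exists 0%N.
- move=> _ [t /fault_d_placement dt <-]; apply/(d_tile_placement d0).
  by exists t.
- move=> _ _ [t ft <-] [t' ft' <-]; have dn0 : d != 0 by rewrite gt_eqF.
  rewrite !interior_region; try exact: d_placement_gt0 dn0 (fault_d_placement _).
  move=> [p [ip ip']]; congr region; apply: contrapT => neq.
  exact: (ap _ _ ft ft' neq _ ip ip').
Qed.

Lemma fault_of_plane : of_plane fault_tiles.
Proof.
have [_ _ _ cov] := fault_plane_tiling R; apply/seteqP; split=> // p _.
by have [t ft rt] := cov p; exists (region t) => //; exists t.
Qed.

Definition fault_disk : set (R * R) := [set p | `|p| <= 10].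

(** The radius 10 is generous: coordinates vary by at most 2 psi^-1 within a tile, which is at most
    4. *)
Lemma fault_disk_sub t p : fault_tiling t -> region t p -> `|p| <= 1 ->
  region t `<=` fault_disk.
Proof.
move=> ft tp p1 q tq; have [h1 h2] := fault_dist ft tp tq.
have d2 : s^-1 <= 2.
  by rewrite -[leRHS]invrK lef_pV2 ?posrE ?psi_gt0 ?invr_gt0 //; psi_order R; lra.
rewrite /fault_disk /= prod_normE ge_max; move: p1; rewrite prod_normE ge_max.
move: h1 h2; rewrite !ler_norml => h1 h2 /andP[p1 p2]; apply/andP; split; lra.
Qed.

Lemma core_disk t e : fault_tiling t -> e \in arrows t ->
  e \in core R \/ turn e \in core R -> region t `<=` fault_disk.
Proof.
move=> ft et ce; have dn0 : d != 0 by rewrite gt_eqF ?inv_psi_gt0.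
have t0 := d_placement_gt0 dn0 (fault_d_placement ft).
have te : region t (source e) := (arrow_in_region t0 et (segment_source e)).1.
apply: fault_disk_sub ft te _.
have : segment (unit_arrow R) (source e).
  case: ce => ce; first exact: core_unit ce _ (segment_source e).
  apply: turn_unit; rewrite segment_turn; exists (source (turn e)).
    exact: core_unit ce _ (segment_source _).
  by rewrite -[RHS]/(source e) -{2}(turnK e).
move=> /segment_horiz /= [e2 h]; rewrite prod_normE ge_max e2 normr0 ler01 andbT.
by rewrite ler_norml; case: h; lra.
Qed.

Lemma fault_violation X Y : fault_tiles X -> fault_tiles Y ->
  arrow_violation d X Y -> X `<=` fault_disk /\ Y `<=` fault_disk.
Proof.
have d0 := inv_psi_gt0 R.
move=> [t ft <-] [t' ft' <-] [neq viol]; apply: contrapT => nd; apply: viol.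
apply/(arrow_compatible_placement d0 (fault_d_placement ft) (fault_d_placement ft')).
have neq' : t <> t' by move=> e; apply: neq; rewrite e.
move: (ft) (ft') neq' => [ut|[t0 u0 et]] [ut'|[t0' u0' et']] neq' e e' he he' o.
- exact: ((legal_upper R).2 _ _ ut ut' neq').2.
- have he2 := he'; rewrite et' in he2.
  have [//|[ce ce']] := fault_compatible ut u0' he he2 o.
  case: nd; split; first by apply: core_disk ft he _; left.
  by apply: core_disk ft' he' _; right.
- have he2 := he; rewrite et in he2.
  have [//|[ce' ce]] := fault_compatible ut' u0 he' he2 (overlap_sym o).
  case: nd; split; first by apply: core_disk ft he _; right.
  by apply: core_disk ft' he' _; left.
- have k := compatible_map (g := half_turn R) _ (((legal_upper R).2 _ _ u0 u0' _).2).
  apply: k => //; rewrite ?ratio2_half_turn // -?/(turned _) -?et -?et' //.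
  by move=> e0; apply: neq'; rewrite et et' e0.
Qed.

Lemma fault_disk_bounded : bounded_set fault_disk.
Proof.
by exists 10; split; [exact: num_real | move=> M hM p hp; exact: le_trans hp (ltW hM)].
Qed.

Lemma fault_tiles_difference (T' : set (set (R * R))) :
  A2_tiling T' -> of_plane T' -> infinite_set (fault_tiles `\` T').
Proof.
move=> [d' tT' rT'] pT'; have [d'0 _ tileT' _] := tT'.
have d0 := inv_psi_gt0 R; have dn0 : d != 0 by rewrite gt_eqF.
have [e|dd'] := eqVneq d' d.
  subst d' => fin.
  have hP' := placements_plane_tiling d0 tT' pT'.
  apply: (fault_infinite_difference hP') => [t [] //|t t'|].
    exact: placements_compatible d0 _ rT' t t'.
  (* Carries finiteness over from tiles to placements. The default value [seed R] is never taken on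
     tiles of [fault_tiles]. *)
  pose pick X : placement R := xget (seed R) [set t | fault_tiling t /\ region t = X].
  apply: (@sub_finite_set _ _ (pick @` (fault_tiles `\` T'))); last exact: finite_image.
  move=> t [ft nt]; exists (region t).
    split; first by exists t.
    by move=> Tt; apply: nt; split=> //; exact: fault_d_placement.
  rewrite /pick; case: xgetP => [t1 _ [ft1 rt1]|/(_ t) []//].
  exact: d_placement_region_inj dn0 (fault_d_placement ft1) (fault_d_placement ft) rt1.
(* If d = psi d', the small d-tiles are smaller than all d'-tiles. Otherwise the large d-tiles have
   neither of the two sizes of d'-tiles. *)
have [k hk] : exists k, forall t, fault_tiling t -> is_large t = k -> ~ T' (region t).
  have same t : fault_tiling t -> T' (region t) ->
      exists k, (if is_large t then 1 else s ^+ 2) * d ^+ 2 =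
        (if k then 1 else s ^+ 2) * d' ^+ 2.
    move=> ft Tt; have [t1 dt1 rt1] := (d_tile_placement d'0 _).1 (tileT' _ Tt).
    have dt := fault_d_placement ft; exists (is_large t1).
    have dn' : d' != 0 by rewrite gt_eqF.
    have [_ ea _] := region_inj (d_placement_gt0 dn' dt1) (d_placement_gt0 dn0 dt) rt1.
    by rewrite -dt -dt1 /ratio2 ea.
  have dne : d ^+ 2 <> d' ^+ 2.
    move=> e2; move: dd'; rewrite -(eqrXn2 (n := 2)) ?(ltW d0) ?(ltW d'0) //.
    by rewrite e2 eqxx.
  have k2 : 0 < s ^+ 2 < 1 by psi_order R; lra.
  have [Tl|Tl] := pselect (d ^+ 2 = s ^+ 2 * d' ^+ 2).
    exists false => t ft kt /(same t ft) [k]; rewrite kt; case: k => h.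
      have d2 : 0 < d ^+ 2 by rewrite exprn_gt0.
      rewrite mul1r in h; rewrite -h mulrA in Tl.
      have : s ^+ 2 * s ^+ 2 * d ^+ 2 < d ^+ 2.
        rewrite -[ltRHS]mul1r ltr_pM2r //; case/andP: k2 => ? ?.
        by rewrite -[ltRHS]mulr1 ltr_pM // ltW.
      by rewrite -Tl ltxx.
    have k2n : s ^+ 2 != 0 by rewrite gt_eqF //; case/andP: k2.
    by apply: dne; exact: (mulfI k2n h).
  exists true => t ft kt /(same t ft) [k]; rewrite kt mul1r; case: k => h.
    by apply: dne; rewrite h mul1r.
  exact: Tl.
move=> fin; apply: (infinite_kind (R := R) (k := k)).
apply: sub_finite_set fin => _ [t [ut kt] <-]; have ft : fault_tiling t by left.
by split; [exists t | exact: hk].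
Qed.

End FaultTiles.

Theorem theorem5 (R : realType) :
  exists (d : R) (T : set (set (R * R))),
    [/\ d_tiling d T,
        of_plane T,
        (exists2 D : set (R * R), bounded_set D &
           forall X Y, T X -> T Y -> arrow_violation d X Y ->
             X `<=` D /\ Y `<=` D)
      & forall T' : set (set (R * R)), A2_tiling T' -> of_plane T' ->
          infinite_set (T `\` T')].
Proof.
exists (psi R)^-1, (@fault_tiles R); split.
- exact: fault_d_tiling.
- exact: fault_of_plane.
- exists (@fault_disk R); first exact: fault_disk_bounded.
  exact: fault_violation.
- exact: fault_tiles_difference.
Qed.
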